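(* Let $\{x_i^{(t)}\}$ be generated by the decentralized dual averaging (DDA) algorithm described in the context, for Problem $\min_{x\in\mathcal X} f(x)=\frac1n\sum_{i=1}^n f_i(x)$, under the assumptions on $f_i$ and $P$ stated in the context. Let $\beta=\sigma_2(P)$ and let $\rho(\mathbf M)$ be the spectral radius of $$\mathbf M=\begin{bmatrix}\beta&\beta\\ aL(\beta+1)&\beta(aL+1)\end{bmatrix}.$$ Suppose that the constant $a>0$ of the algorithm satisfies $$\frac1a>2L\cdot\max\left\{\frac{\beta}{(1-\beta)^2},\;1+\frac{8}{9\left(1-(\rho(\mathbf M))^2\right)}\right\}.$$ Let $\overline z^{(t)}=\frac1n\sum_{i=1}^n z_i^{(t)}$, $y^{(0)}=x^{(0)}$, $y^{(t)}=\nabla d^*(-a\overline z^{(t)})$, $\tilde y^{(t)}=t^{-1}\sum_{\tau=1}^t y^{(\tau)}$, $\tilde x_i^{(t)}=t^{-1}\sum_{\tau=1}^t x_i^{(\tau)}$, and $$\pi^2=\sum_{i=1}^n\Big\|\nabla f_i(x^{(0)})-\frac1n\sum_{j=1}^n\nabla f_j(x^{(0)})\Big\|^2 .$$ Then, for all $t\ge1$, $$f(\tilde y^{(t)})-f(x^* )\le\frac{C}{at},\qquad C:=d(x^* )+\frac{8a\pi^2}{9nL\left(1-(\rho(\mathbf M))^2\right)}.$$ In addition, for all $t\ge1$ and $i=1,\dots,n$, $$\|\tilde x_i^{(t)}-\tilde y^{(t)}\|^2\le\frac Dt,\qquad D:=\frac{8nC}{9\gamma\left(1-\rho(\mathbf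 M)\right)^2}+\frac{8\pi^2}{9L^2\left(1-(\rho(\mathbf M))^2\right)},$$ where $$\gamma:=\frac12-aL-\frac{8aL}{9\left(1-(\rho(\mathbf M))^2\right)} .$$
   Context: **Problem.** $n\ge 2$ agents; $\mathcal X\subseteq\mathbb R^m$ is a (nonempty) convex and compact set; $f=\frac1n\sum_{i=1}^n f_i$; $x^*$ denotes an optimal solution of $\min_{x\in\mathcal X}f(x)$. $\|\cdot\|$ is the Euclidean norm. **Assumption on $f_i$.** For each $i$: $f_i$ is continuously differentiable on $\mathcal X$; $f_i$ is convex on $\mathcal X$, i.e. $f_i(x)-f_i(y)-\langle\nabla f_i(y),x-y\rangle\ge0$ for all $x,y\in\mathcal X$; and $\|\nabla f_i(x)-\nabla f_i(y)\|\le L\|x-y\|$ for all $x,y\in\mathcal X$, with $L>0$. **Network.** $\mathcal G=(\{1,\dots,n\},\mathcal E)$ is a connected undirected graph; $P=[p_{ij}]\in[0,1]^{n\times n}$ has $p_{ij}>0$ if $(i,j)\in\mathcal E$ and $p_{ij}=0$ for $i\ne j$ with $(i,j)\notin\mathcal E$. Assumption on $P$: $P\mathbf 1=\mathbf 1$, $\mathbf 1^{\mathrm T}P=\mathbf 1^{\mathrm T}$ ($\mathbf 1$ the all-one vector), and $p_{ii}>0$ for all $i$. $\sigma_1(P)\ge\sigma_2(P)\ge\cdots$ are the singular values of $P$; under these assumptions $\sigma_2(P)<1$. **Prox-function.** $d$ is a differentiable function that is strongly convex with modulus $1$ on $\mathcal X$, i.e. $d(x)-d(y)-\langle\nabla d(y),x-y\rangle\ge\frac12\|x-y\|^2$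 for all $x,y\in\mathcal X$, with $x^{(0)}=\operatorname{argmin}_{x\in\mathcal X}d(x)$ and $d(x^{(0)})=0$. For $z\in\mathbb R^m$, $\nabla d^*(z):=\operatorname{argmax}_{x\in\mathcal X}\{\langle z,x\rangle-d(x)\}$. **DDA algorithm (Algorithm 1).** Input $a>0$, $x^{(0)}$, $d$. Initialize $x_i^{(0)}=x^{(0)}$, $z_i^{(0)}=0$, $s_i^{(0)}=\nabla f_i(x^{(0)})$ for all $i$. For $t=1,2,\dots$ and every $i$: $$z_i^{(t)}=\sum_{j=1}^n p_{ij}\big(z_j^{(t-1)}+s_j^{(t-1)}\big),\qquad x_i^{(t)}=\nabla d^*(-a z_i^{(t)}),$$ $$s_i^{(t)}=\sum_{j=1}^n p_{ij}s_j^{(t-1)}+\nabla f_i(x_i^{(t)})-\nabla f_i(x_i^{(t-1)}).$$ *)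

(* Defs.v *)
From HB Require Import structures.
From mathcomp Require Import all_boot all_order all_algebra.
From mathcomp Require Import polyrcf complex.
From mathcomp Require Import all_classical all_reals all_analysis.

Set Implicit Arguments.
Unset Strict Implicit.
Unset Printing Implicit Defensive.

Import Order.TTheory GRing.Theory Num.Theory.
Import numFieldNormedType.Exports.

Local Open Scope classical_set_scope.
Local Open Scope ring_scope.

(* The norm `|u| that the library puts on 'rV[R]_m is the sup norm: it gives
   the same topology and differentials, but not the Euclidean norm. *)
Definition dot {R : realType} {m : nat} (u v : 'rV[R]_m) : R :=
  \sum_(j < m) u 0 j * v 0 j.

Definition enorm {R : realType} {m : nat} (u : 'rV[R]_m) : R :=
  Num.sqrt (dot u u).

(* Vector of partial derivatives; it represents 'd f x when f is
   differentiable at x. *)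
Definition grad {R : realType} {m : nat} (f : 'rV[R]_m -> R) (x : 'rV[R]_m) :
    'rV[R]_m :=
  \row_(j < m) 'D_(delta_mx 0 j) f x.

(* Functions are defined on the whole space, and differentiability at a point
   of X is Fréchet differentiability in the ambient space: the gradient is thus
   well defined on X even if X has empty interior. *)
Definition differentiable_on {R : realType} {m : nat} (X : set 'rV[R]_m)
    (f : 'rV[R]_m -> R) : Prop :=
  forall x, X x -> differentiable f x.

Definition cont_differentiable_on {R : realType} {m : nat}
    (X : set 'rV[R]_m) (f : 'rV[R]_m -> R) : Prop :=
  differentiable_on X f /\ {within X, continuous (grad f)}.

Definition strongly_convex_on {R : realType} {m : nat} (mu : R)
    (X : set 'rV[R]_m) (f : 'rV[R]_m -> R) : Prop :=
  forall x y, X x -> X y ->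
    f x - f y - dot (grad f y) (x - y) >= mu / 2 * enorm (x - y) ^+ 2.

Definition diff_convex_on {R : realType} {m : nat}
    (X : set 'rV[R]_m) (f : 'rV[R]_m -> R) : Prop :=
  forall x y, X x -> X y -> f x - f y - dot (grad f y) (x - y) >= 0.

Definition lipschitz_grad_on {R : realType} {m : nat} (L : R)
    (X : set 'rV[R]_m) (f : 'rV[R]_m -> R) : Prop :=
  forall x y, X x -> X y ->
    enorm (grad f x - grad f y) <= L * enorm (x - y).

Definition is_argmin_on {R : realType} {m : nat} (X : set 'rV[R]_m)
    (g : 'rV[R]_m -> R) (x : 'rV[R]_m) : Prop :=
  X x /\ forall y, X y -> g x <= g y.

Definition is_argmax_on {R : realType} {m : nat} (X : set 'rV[R]_m)
    (g : 'rV[R]_m -> R) (x : 'rV[R]_m) : Prop :=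
  X x /\ forall y, X y -> g y <= g x.

(* The maximizer exists and is unique when X is nonempty and compact and d is
   differentiable and strongly convex on X; 0 is a default value otherwise. *)
Definition grad_conj {R : realType} {m : nat} (X : set 'rV[R]_m)
    (d : 'rV[R]_m -> R) (z : 'rV[R]_m) : 'rV[R]_m :=
  xget 0 [set x | is_argmax_on X (fun x => dot z x - d x) x].

Definition favg {R : realType} {n m : nat} (f : 'I_n -> 'rV[R]_m -> R)
    (x : 'rV[R]_m) : R :=
  n%:R^-1 * \sum_(i < n) f i x.

Definition connected_graph {n : nat} (E : rel 'I_n) : Prop :=
  symmetric E /\ forall i j : 'I_n, connect E i j.

Definition weight_matrix {R : realType} {n : nat} (E : rel 'I_n)
    (P : 'M[R]_n) : Prop :=
  [/\ forall i j, 0 <= P i j <= 1,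
      forall i j, E i j -> 0 < P i j &
      forall i j, i != j -> ~~ E i j -> P i j = 0].

Definition doubly_stochastic_posdiag {R : realType} {n : nat}
    (P : 'M[R]_n) : Prop :=
  [/\ P *m const_mx 1 = const_mx 1 :> 'cV[R]_n,
      const_mx 1 *m P = const_mx 1 :> 'rV[R]_n &
      forall i, 0 < P i i].

(* Real roots in increasing order, each repeated according to its
   multiplicity. *)
Definition roots_with_mult {R : realType} (p : {poly R}) : seq R :=
  flatten [seq nseq (mup x p) x | x <- rootsR p].

(* In nonincreasing order: sigma_k is (singular_values A)`_(k - 1). *)
Definition singular_values {R : realType} {n : nat} (A : 'M[R]_n) : seq R :=
  sort >=%R [seq Num.sqrt x | x <- roots_with_mult (char_poly (A^T *m A))].

(* Largest modulus of a complex eigenvalue. *)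
Definition spectral_radius {R : realType} {n : nat} (A : 'M[R]_n) : R :=
  sup [set ComplexField.Normc.normc w |
       w in [set w : R[i] | eigenvalue (map_mx (real_complex R) A) w]].

Definition rate_matrix {R : realType} (a L beta : R) : 'M[R]_2 :=
  \matrix_(i < 2, j < 2)
    (if i == 0 then beta
     else if j == 0 then a * L * (beta + 1) else beta * (a * L + 1)).

Record dda_run {R : realType} {n m : nat} (X : set 'rV[R]_m)
    (f : 'I_n -> 'rV[R]_m -> R) (P : 'M[R]_n) (d : 'rV[R]_m -> R) (a : R)
    (x0 : 'rV[R]_m) (x z s : nat -> 'I_n -> 'rV[R]_m) : Prop := DdaRun {
  dda_x0 : forall i, x 0%N i = x0;
  dda_z0 : forall i, z 0%N i = 0;
  dda_s0 : forall i, s 0%N i = grad (f i) x0;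
  dda_z : forall t i,
    z t.+1 i = \sum_(j < n) P i j *: (z t j + s t j);
  dda_x : forall t i, x t.+1 i = grad_conj X d (- (a *: z t.+1 i));
  dda_s : forall t i,
    s t.+1 i = \sum_(j < n) P i j *: s t j
               + grad (f i) (x t.+1 i) - grad (f i) (x t i) }.

Definition run_avg {R : realType} {m : nat} (u : nat -> 'rV[R]_m) (t : nat) :
    'rV[R]_m :=
  t%:R^-1 *: \sum_(1 <= tau < t.+1) u tau.

(* Main.v *)
(* A prox step is 1-Lipschitz in the dual variable, so the consensus errors of
   z and s obey the linear recursion with matrix M, driven by the increments of
   y; the initial error pi acts as an impulse at time 0. The l2-gain of this
   positive system is its DC gain, the entry of (1 - M)^-1 in position (1, 2),
   and the step-size condition bounds a L times this gain by
   sqrt (8 / (9 (1 - rho^2))). Dual averaging on y with the inexact gradient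
   mean_i (grad f_i (x_i)) then leaves a multiple of gamma of the squared
   increments of y, which pays for the consensus error. *)
Require Import Defs.
From HB Require Import structures.
From mathcomp Require Import all_boot all_order all_algebra.
From mathcomp Require Import polyrcf complex.
From mathcomp Require Import all_classical all_reals all_analysis.
From mathcomp Require Import ring lra.
Import Order.TTheory GRing.Theory Num.Theory.
Import numFieldNormedType.Exports.
Local Open Scope classical_set_scope.
Local Open Scope ring_scope.

Set Implicit Arguments.
Unset Strict Implicit.
Unset Printing Implicit Defensive.

(** The two entries of the maximum do separate work. The first makes
    [det (1 - M) = (1 - beta)^2 - 2 a L beta] positive, whence rho < 1 and a finite gain
    [beta / det (1 - M)]. The second makes gamma positive and, rho < 1 being known, yields the bound
    on the gain. M need not be normal, so rho does not control a single step in the Euclidean norm;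
    entrywise nonnegativity is used instead, through the explicit inverse of 1 - M. Another obstacle
    lies in beta, an entry of a sorted list of roots of a characteristic polynomial: that beta < 1
    and that mixing contracts zero-sum vectors by beta has to be extracted from multiplicities of
    roots. *)

(** * Euclidean geometry of vectors and of families of vectors *)

Section Euclidean.
Context {R : realType}.
Implicit Types m n : nat.

Lemma dotC {m} (u v : 'rV[R]_m) : dot u v = dot v u.
Proof. by apply: eq_bigr => j _; rewrite mulrC. Qed.

Lemma dotDl {m} (u v w : 'rV[R]_m) : dot (u + v) w = dot u w + dot v w.
Proof. by rewrite -big_split; apply: eq_bigr => j _; rewrite mxE mulrDl. Qed.

Lemma dotZl {m} (k : R) (u w : 'rV[R]_m) : dot (k *: u) w = k * dot u w.
Proof. by rewrite mulr_sumr; apply: eq_bigr => j _; rewrite mxE mulrA. Qed.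

Lemma dotNl {m} (u w : 'rV[R]_m) : dot (- u) w = - dot u w.
Proof. by rewrite -scaleN1r dotZl mulN1r. Qed.

Lemma dotBl {m} (u v w : 'rV[R]_m) : dot (u - v) w = dot u w - dot v w.
Proof. by rewrite dotDl dotNl. Qed.

Lemma dot0l {m} (w : 'rV[R]_m) : dot 0 w = 0.
Proof. by rewrite -(scale0r (0 : 'rV[R]_m)) dotZl mul0r. Qed.

Lemma dotDr {m} (u v w : 'rV[R]_m) : dot w (u + v) = dot w u + dot w v.
Proof. by rewrite dotC dotDl !(dotC w). Qed.

Lemma dotZr {m} (k : R) (u w : 'rV[R]_m) : dot w (k *: u) = k * dot w u.
Proof. by rewrite dotC dotZl (dotC w). Qed.

Lemma dotNr {m} (u w : 'rV[R]_m) : dot w (- u) = - dot w u.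
Proof. by rewrite dotC dotNl (dotC w). Qed.

Lemma dotBr {m} (u v w : 'rV[R]_m) : dot w (u - v) = dot w u - dot w v.
Proof. by rewrite dotDr dotNr. Qed.

Lemma dot_suml {m} (I : Type) (r : seq I) (Q : pred I) (F : I -> 'rV[R]_m) w :
  dot (\sum_(i <- r | Q i) F i) w = \sum_(i <- r | Q i) dot (F i) w.
Proof.
by elim/big_rec2: _ => [|i x y _ <-]; rewrite ?dot0l ?dotDl.
Qed.

Lemma dot_ge0 {m} (u : 'rV[R]_m) : 0 <= dot u u.
Proof. by apply: sumr_ge0 => j _; rewrite -expr2 sqr_ge0. Qed.

Lemma dot_eq0 {m} (u : 'rV[R]_m) : (dot u u == 0) = (u == 0).
Proof.
apply/idP/eqP => [|->]; last by rewrite dot0l.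
rewrite psumr_eq0 => [|j _]; last by rewrite -expr2 sqr_ge0.
move=> /allP u0; apply/rowP => j; rewrite mxE.
by have := u0 j (mem_index_enum _); rewrite /= mulf_eq0 orbb => /eqP.
Qed.

Lemma enorm_ge0 {m} (u : 'rV[R]_m) : 0 <= enorm u.
Proof. exact: sqrtr_ge0. Qed.

Lemma enorm_sqr {m} (u : 'rV[R]_m) : enorm u ^+ 2 = dot u u.
Proof. by rewrite sqr_sqrtr ?dot_ge0. Qed.

Lemma enormZ {m} (k : R) (u : 'rV[R]_m) : enorm (k *: u) = `|k| * enorm u.
Proof.
by rewrite /enorm dotZl dotZr mulrA -expr2 sqrtrM ?sqr_ge0// sqrtr_sqr.
Qed.

Lemma enormZ_sqr m (k : R) (u : 'rV[R]_m) :
  enorm (k *: u) ^+ 2 = k ^+ 2 * enorm u ^+ 2.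
Proof. by rewrite !enorm_sqr dotZl dotZr mulrA. Qed.

Lemma enormN {m} (u : 'rV[R]_m) : enorm (- u) = enorm u.
Proof. by rewrite -scaleN1r enormZ normrN1 mul1r. Qed.

Lemma enorm0 {m} : enorm (0 : 'rV[R]_m) = 0.
Proof. by rewrite /enorm dot0l sqrtr0. Qed.

Lemma enormBC {m} (u v : 'rV[R]_m) : enorm (u - v) = enorm (v - u).
Proof. by rewrite -enormN opprB. Qed.

Lemma dot_le_enorm {m} (u v : 'rV[R]_m) : dot u v <= enorm u * enorm v.
Proof.
have [->|u0] := eqVneq u 0; first by rewrite dot0l enorm0 mul0r.
have uu : 0 < dot u u by rewrite lt_neqAle dot_ge0 eq_sym dot_eq0 u0.
apply: le_trans (ler_norm _) _.
rewrite -ler_sqr ?nnegrE ?normr_ge0 ?mulr_ge0 ?enorm_ge0//.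
rewrite exprMn !enorm_sqr real_normK ?num_real//.
have := dot_ge0 (dot u u *: v - dot u v *: u).
rewrite dotBl !dotBr !dotZl !dotZr (dotC v u) => h.
rewrite -subr_ge0 -(pmulr_rge0 _ uu).
by apply: le_trans h _; rewrite le_eqVlt; apply/orP; left; apply/eqP; ring.
Qed.

Lemma ler_enormD {m} (u v : 'rV[R]_m) : enorm (u + v) <= enorm u + enorm v.
Proof.
rewrite -ler_sqr ?nnegrE ?addr_ge0 ?enorm_ge0//.
rewrite sqrrD !enorm_sqr dotDl !dotDr (dotC v u).
have := dot_le_enorm u v; lra.
Qed.

Lemma enorm_sqrD_le {m} (u v : 'rV[R]_m) :
  enorm (u + v) ^+ 2 <= 2 * enorm u ^+ 2 + 2 * enorm v ^+ 2.
Proof.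
rewrite !enorm_sqr; have := dot_ge0 (u - v).
rewrite !(dotDl, dotDr, dotNl, dotNr) (dotC v u); lra.
Qed.

(* Concatenating an n-family of vectors into one long row gives the families
   the Euclidean norm (the Frobenius norm of the stacked matrix). *)
Definition stack {n m} (V : 'I_n -> 'rV[R]_m) : 'rV[R]_(n * m) :=
  mxvec (\matrix_(i, j) V i 0 j).

Lemma dot_stack {n m} (V W : 'I_n -> 'rV[R]_m) :
  dot (stack V) (stack W) = \sum_i dot (V i) (W i).
Proof.
rewrite /dot (reindex _ (curry_mxvec_bij _ _)) /= pair_bigA /=.
by apply: eq_bigr => -[i j] _; rewrite !mxvecE !mxE.
Qed.

Lemma enorm_stack_sqr {n m} (V : 'I_n -> 'rV[R]_m) :
  enorm (stack V) ^+ 2 = \sum_i enorm (V i) ^+ 2.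
Proof.
by rewrite enorm_sqr dot_stack; apply: eq_bigr => i _; rewrite enorm_sqr.
Qed.

Lemma stackD {n m} (V W : 'I_n -> 'rV[R]_m) :
  stack (fun i => V i + W i) = stack V + stack W.
Proof. by rewrite -linearD; congr mxvec; apply/matrixP => i j; rewrite !mxE. Qed.

Lemma enorm_stack_le {n m} (V W : 'I_n -> 'rV[R]_m) (k : R) : 0 <= k ->
  (forall i, enorm (V i) <= k * enorm (W i)) ->
  enorm (stack V) <= k * enorm (stack W).
Proof.
move=> k0 VW; rewrite -ler_sqr ?nnegrE ?mulr_ge0 ?enorm_ge0//.
rewrite exprMn !enorm_stack_sqr mulr_sumr; apply: ler_sum => i _.
by rewrite -exprMn ler_sqr ?nnegrE ?mulr_ge0 ?enorm_ge0.
Qed.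

Lemma enorm_stack_cst {n m} (v : 'rV[R]_m) :
  enorm (stack (fun _ : 'I_n => v)) = Num.sqrt n%:R * enorm v.
Proof.
apply/eqP; rewrite -(@eqrXn2 _ 2) ?mulr_ge0 ?sqrtr_ge0 ?enorm_ge0//.
rewrite exprMn enorm_stack_sqr (sqr_sqrtr (ler0n R n)).
by rewrite sumr_const card_ord mulr_natl.
Qed.

Definition fmean {n m} (V : 'I_n -> 'rV[R]_m) : 'rV[R]_m :=
  n%:R^-1 *: \sum_(i < n) V i.

Lemma fmeanD {n m} (V W : 'I_n -> 'rV[R]_m) :
  fmean (fun i => V i + W i) = fmean V + fmean W.
Proof. by rewrite /fmean big_split scalerDr. Qed.

Lemma sum_fmean {n m} (V : 'I_n -> 'rV[R]_m) : (0 < n)%N ->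
  \sum_(i < n) V i = n%:R *: fmean V.
Proof.
by move=> n0; rewrite scalerA divff ?scale1r// pnatr_eq0 -lt0n.
Qed.

Lemma sum_sub_fmean {n m} (V : 'I_n -> 'rV[R]_m) : (0 < n)%N ->
  \sum_(i < n) (V i - fmean V) = 0.
Proof.
move=> n0; rewrite sumrB sum_fmean// sumr_const card_ord.
by rewrite scaler_nat subrr.
Qed.

(** Centering is an orthogonal projection: deviations from the mean are orthogonal to constant
    families. Hence removing the mean from the gradient increments costs nothing in the recursion
    for [s]. *)
Lemma enorm_stack_sub_fmean {n m} (V : 'I_n -> 'rV[R]_m) : (0 < n)%N ->
  enorm (stack (fun i => V i - fmean V)) <= enorm (stack V).
Proof.
move=> n0; rewrite -ler_sqr ?nnegrE ?enorm_ge0// !enorm_stack_sqr.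
have E i : enorm (V i) ^+ 2 = enorm (V i - fmean V) ^+ 2 +
    2 * dot (V i - fmean V) (fmean V) + dot (fmean V) (fmean V).
  by rewrite !enorm_sqr !(dotDl, dotDr, dotNl, dotNr) (dotC (fmean V)); ring.
under [leRHS]eq_bigr do rewrite E.
rewrite !big_split /= -mulr_sumr -dot_suml sum_sub_fmean// dot0l mulr0 addr0.
by rewrite lerDl sumr_ge0// => i _; exact: dot_ge0.
Qed.

End Euclidean.

Lemma continuous_dot {R : realType} (T : topologicalType) m
    (F G : T -> 'rV[R]_m) :
  (forall j, continuous (fun t => F t 0 j)) ->
  (forall j, continuous (fun t => G t 0 j)) ->
  continuous (fun t => dot (F t) (G t)).
Proof.
move=> cF cG; apply: continuous_big => [|j _ t]; first exact: add_continuous.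
by apply: cvgM; [exact: cF|exact: cG].
Qed.

(** * Convexity, smoothness and the prox map *)

Section Convexity.
Context {R : realType} {m : nat}.
Implicit Types (X : set 'rV[R]_m) (f d : 'rV[R]_m -> R).

(** Elementary form of the limit [k -> 0]: if [B < A], the [k] that makes [(1 - k) * A] the midpoint
    of [A] and [B] contradicts the hypothesis. *)
Lemma le_of_le_onem (A B : R) : 0 <= A ->
  (forall k : R, 0 < k < 1 -> (1 - k) * A <= B) -> A <= B.
Proof.
move=> A0 h; have [//|BA] := leP A B.
have : 0 < (2^-1 : R) < 1 by lra.
move=> /h hB; have {}A0 : 0 < A by lra.
have : 0 < (A - B) / (2 * A) < 1.
  by rewrite divr_gt0 ?ltr_pdivrMr /=; lra.
move=> /h; have -> : (1 - (A - B) / (2 * A)) * A = (A + B) / 2.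
  by field; rewrite gt_eqF.
lra.
Qed.

Lemma convex_set_comb X x y (k : R) :
  convex_set (X : set (convex_lmodType 'rV[R]_m)) ->
  X x -> X y -> 0 <= k <= 1 -> X (k *: x + (1 - k) *: y).
Proof.
move=> cX Xx Xy /andP[k0 k1].
by have := cX x y (Itv01 k0 k1); rewrite !inE; apply.
Qed.

Lemma convex_set_mean X (u : nat -> 'rV[R]_m) t :
  convex_set (X : set (convex_lmodType 'rV[R]_m)) ->
  (forall k, X (u k.+1)) -> (0 < t)%N -> X (run_avg u t).
Proof.
move=> cX Xu; case: t => // t _; elim: t => [|t IH].
  by rewrite /run_avg big_nat1 invr1 scale1r.
have t0 : (t.+2%:R : R) != 0 by rewrite pnatr_eq0.
have t0' : (t.+1%:R : R) != 0 by rewrite pnatr_eq0.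
have -> : run_avg u t.+2 =
    (t.+1%:R / t.+2%:R) *: run_avg u t.+1 + (1 - t.+1%:R / t.+2%:R) *: u t.+2.
  rewrite /run_avg big_nat_recr//= scalerA mulrAC divff// div1r scalerDr.
  congr (_ + _ *: _); apply: (mulIf t0).
  by rewrite mulVf// mulrBl mul1r divfK// -natrB// subSn// subnn.
apply: convex_set_comb => //; rewrite divr_ge0 ?ler0n//=.
by rewrite ler_pdivrMr ?ltr0n// mul1r ler_nat.
Qed.

(** Jensen's inequality: in the gradient inequalities taken at the average, the linear terms sum to
    zero. *)
Lemma diff_convex_run_avg X f (u : nat -> 'rV[R]_m) t :
  convex_set (X : set (convex_lmodType 'rV[R]_m)) -> diff_convex_on X f ->
  (forall k, X (u k.+1)) -> (0 < t)%N ->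
  f (run_avg u t) <= t%:R^-1 * \sum_(1 <= k < t.+1) f (u k).
Proof.
move=> cX cf Xu t0; have Xa := convex_set_mean cX Xu t0.
have tR0 : (0 : R) < t%:R by rewrite ltr0n.
rewrite -(ler_pM2l tR0) mulrA divff ?gt_eqF// mul1r.
have : 0 <= \sum_(1 <= k < t.+1) (f (u k) - f (run_avg u t) -
    dot (grad f (run_avg u t)) (u k - run_avg u t)).
  rewrite big_nat_cond; apply: sumr_ge0 => -[|k]//= _.
  exact: cf.
rewrite !sumrB.
under [X in _ - X]eq_bigr do rewrite dotC.
rewrite -dot_suml sumrB !sumr_const_nat subn1 /=.
have -> : \sum_(1 <= k < t.+1) u k = t%:R *: run_avg u t.
  by rewrite scalerA divff ?gt_eqF// scale1r.
by rewrite scaler_nat subrr dot0l subr0 subr_ge0 mulr_natl.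
Qed.

(* Chaining the gradient inequality through [N] equally spaced points of the
   segment gives the bound with L (1 + 1/N) in place of L. *)
Lemma lipschitz_grad_descent X f (L : R) x y :
  convex_set (X : set (convex_lmodType 'rV[R]_m)) -> 0 <= L ->
  diff_convex_on X f -> lipschitz_grad_on L X f -> X x -> X y ->
  f y <= f x + dot (grad f x) (y - x) + L / 2 * enorm (y - x) ^+ 2.
Proof.
move=> cX L0 cf lf Xx Xy; set v := y - x.
suff step N : f y <= f x + dot (grad f x) v +
    L / 2 * enorm v ^+ 2 + L / 2 * enorm v ^+ 2 / N.+1%:R.
  apply/ler_addgt0Pr => e e0.
  set c := L / 2 * enorm v ^+ 2 in step *.
  have c0 : 0 <= c by rewrite mulr_ge0 ?sqr_ge0// divr_ge0.
  apply: le_trans (step (Num.truncn (c / e))) _; rewrite lerD2l.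
  rewrite ler_pdivrMr ?ltr0n// mulrC -ler_pdivrMr//.
  by apply/ltW/truncnS_gt.
set N' : R := N.+1%:R.
have N0 : 0 < N' by rewrite ltr0n.
pose p (k : nat) := x + (k%:R / N') *: v.
have Xp k : (k <= N.+1)%N -> X (p k).
  move=> kN; have -> : p k = (k%:R / N') *: y + (1 - k%:R / N') *: x.
    by apply/rowP => j; rewrite !mxE; ring.
  apply: convex_set_comb => //; rewrite divr_ge0 ?ler0n//=.
  by rewrite ler_pdivrMr// mul1r ler_nat.
(* Convexity is used with the gradient at the far end [p k.+1] of each step, whose distance to
   [grad f x] is at most [L * (k.+1%:R / N') * enorm v]; the sum 1 + ... + k gives the product
   [k%:R * k.+1%:R]. *)
have H k : (k <= N.+1)%N -> f (p k) <= f x + (k%:R / N') * dot (grad f x) v +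
    L / 2 * enorm v ^+ 2 * (k%:R * k.+1%:R / N' ^+ 2).
  elim: k => [_|k IH kN].
    by rewrite /p !mul0r scale0r !addr0 mulr0 addr0.
  have /IH{}IH := ltnW kN.
  have := cf _ _ (Xp _ (ltnW kN)) (Xp _ kN).
  have pE : p k - p k.+1 = - (N'^-1 *: v).
    by apply/rowP => j; rewrite !mxE -(natr1 k); field; rewrite gt_eqF.
  rewrite pE dotNr dotZr opprK => h1.
  have := dot_le_enorm (grad f (p k.+1) - grad f x) v; rewrite dotBl => h2.
  have := lf _ _ (Xp _ kN) Xx.
  rewrite [p k.+1 - x]addrAC subrr add0r enormZ ger0_norm ?divr_ge0 ?ler0n// => h3.
  have h4 : (enorm (grad f (p k.+1) - grad f x)) * enorm v <=
     L * (k.+1%:R / N') * enorm v ^+ 2.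
    by apply: le_trans (ler_wpM2r (enorm_ge0 v) h3) _; rewrite expr2 !mulrA.
  have Ni : 0 < N'^-1 by rewrite invr_gt0.
  rewrite -(natr1 k.+1) -(natr1 k) in h4 IH *.
  have := ler_wpM2l (ltW Ni) (le_trans h2 h4).
  move: h1 IH; rewrite -exprVn; set N1 := N'^-1; set q := enorm v ^+ 2.
  move=> h1 IH h5.
  have -> : f x + (k%:R + 1) * N1 * dot (grad f x) v +
    L / 2 * q * ((k%:R + 1) * (k%:R + 1 + 1) * N1 ^+ 2) =
    f x + k%:R * N1 * dot (grad f x) v + N1 * dot (grad f x) v +
    L / 2 * q * (k%:R * (k%:R + 1) * N1 ^+ 2) +
    N1 * (L * ((k%:R + 1) * N1) * q) by field.
  lra.
have := H N.+1 (leqnn _).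
rewrite /p -/N' divff ?gt_eqF// scale1r mul1r /v addrC subrK -/v.
have -> : L / 2 * enorm v ^+ 2 * (N' * N.+2%:R / N' ^+ 2) =
   L / 2 * enorm v ^+ 2 + L / 2 * enorm v ^+ 2 / N'.
  by rewrite -[N.+2%:R]natr1 -/N'; field; rewrite gt_eqF.
by rewrite addrA.
Qed.

(** Weighting the gradient inequalities at the combined point by [k] and [1 - k] cancels the linear
    terms. *)
Lemma strongly_convex_comb X d x y (k : R) :
  convex_set (X : set (convex_lmodType 'rV[R]_m)) -> strongly_convex_on 1 X d ->
  X x -> X y -> 0 <= k <= 1 ->
  d (k *: x + (1 - k) *: y) <=
  k * d x + (1 - k) * d y - k * (1 - k) / 2 * enorm (x - y) ^+ 2.
Proof.
move=> cX cd Xx Xy k01; set z := (_ + _).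
have Xz : X z by exact: convex_set_comb.
have hx := cd _ _ Xx Xz; have hy := cd _ _ Xy Xz.
have xz : x - z = (1 - k) *: (x - y).
  by apply/rowP => j; rewrite !mxE; ring.
have yz : y - z = - (k *: (x - y)).
  by apply/rowP => j; rewrite !mxE; ring.
move: hx hy; rewrite xz yz enormN !enormZ_sqr dotNr !dotZr.
case/andP: k01 => k0 k1 hx hy.
have := ler_wpM2l k0 hx.
have k1' : 0 <= 1 - k by rewrite subr_ge0.
have := ler_wpM2l k1' hy.
set q := enorm _ ^+ 2; set g := dot _ _; nra.
Qed.

(* Obtained by comparing w with the points of the segment from w to x, which
   avoids the first-order optimality condition. *)
Lemma argmax_strong X d z w :
  convex_set (X : set (convex_lmodType 'rV[R]_m)) -> strongly_convex_on 1 X d ->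
  is_argmax_on X (fun x => dot z x - d x) w ->
  forall x, X x ->
  dot z x - d x + 2^-1 * enorm (x - w) ^+ 2 <= dot z w - d w.
Proof.
move=> cX cd [Xw maxw] x Xx; rewrite -lerBrDl.
apply: le_of_le_onem => [|k /andP[k0 k1]].
  by rewrite mulr_ge0 ?sqr_ge0// invr_ge0 ler0n.
have k01 : 0 <= k <= 1 by rewrite !ltW.
have := strongly_convex_comb cX cd Xx Xw k01.
have := maxw _ (convex_set_comb cX Xx Xw k01).
rewrite dotDr !dotZr; set q := enorm _ ^+ 2 => h1 h2.
rewrite -(ler_pM2l k0); lra.
Qed.

(** Testing the strong maximality of each point at the other and adding gives [enorm (w1 - w2) ^+ 2
    <= dot (z1 - z2) (w1 - w2)]; Cauchy-Schwarz finishes. *)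
Lemma argmax_lipschitz X d z1 z2 w1 w2 :
  convex_set (X : set (convex_lmodType 'rV[R]_m)) -> strongly_convex_on 1 X d ->
  is_argmax_on X (fun x => dot z1 x - d x) w1 ->
  is_argmax_on X (fun x => dot z2 x - d x) w2 ->
  enorm (w1 - w2) <= enorm (z1 - z2).
Proof.
move=> cX cd a1 a2.
have := argmax_strong cX cd a1 (proj1 a2).
have := argmax_strong cX cd a2 (proj1 a1).
rewrite (enormBC w2); have [->|w0] := eqVneq (enorm (w1 - w2)) 0.
  by move=> *; exact: enorm_ge0.
move=> h1 h2; have e0 : 0 < enorm (w1 - w2) by rewrite lt_neqAle eq_sym w0 enorm_ge0.
have := dot_le_enorm (z1 - z2) (w1 - w2).
rewrite !(dotBl, dotBr) => h3; rewrite -(ler_pM2r e0) -expr2; lra.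
Qed.

(** The extreme value theorem provides a maximizer, so the default value of [xget] is not taken. *)
Lemma grad_conjP X d z : X !=set0 -> compact X -> differentiable_on X d ->
  is_argmax_on X (fun x => dot z x - d x) (grad_conj X d z).
Proof.
move=> X0 cX dd.
have cz : continuous (fun x : 'rV[R]_m => dot z x).
  apply: (@continuous_dot _ _ _ (fun=> z) id) => j.
    exact: cst_continuous.
  exact: coord_continuous.
have : {within X, continuous (fun x => dot z x - d x)}.
  apply: continuous_in_subspaceT => x; rewrite inE => Xx.
  exact: continuousB (cz x) (differentiable_continuous (dd _ Xx)).
move=> /(EVT_max_rV X0 cX)[c]; rewrite inE => Xc maxc.
apply: (@xgetPex _ 0 [set x | is_argmax_on X (fun x => dot z x - d x) x]).
by exists c; split=> // y Xy; apply: maxc; rewrite inE.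
Qed.

End Convexity.

(** * Rayleigh quotients, deflation and the second root *)

Section SymmetricMatrices.
Context {R : realType}.

Lemma dot_mulmxE m (u v : 'rV[R]_m) : (u *m v^T) 0 0 = dot u v.
Proof. by rewrite mxE; apply: eq_bigr => j _; rewrite mxE. Qed.

Lemma dot_mulmx m (A : 'M[R]_m) (u v : 'rV[R]_m) :
  dot (u *m A) v = dot u (v *m A^T).
Proof. by rewrite -!dot_mulmxE trmx_mul trmxK mulmxA. Qed.

Lemma compact_sphere n : compact [set v : 'rV[R]_n | dot v v = 1].
Proof.
have cid j : continuous (fun v : 'rV[R]_n => v 0 j) by exact: coord_continuous.
apply: bounded_closed_compact; last first.
  apply: (@preimage_closed _ _ (fun v : 'rV[R]_n => dot v v) [set 1]).
    by move=> v _; exact: (continuous_dot cid cid).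
  exact: closed_eq.
exists 1; split=> // M M1 v /= v1.
apply: le_trans (ltW M1); rewrite /Num.norm /= mx_normrE.
apply/bigmax_leP; split=> // -[i j] _ /=; rewrite ord1.
rewrite -(@ler_pXn2r _ 2) ?nnegrE// expr1n real_normK ?num_real// -v1.
rewrite /dot (bigD1 j)//= -expr2 lerDl sumr_ge0// => k _.
by rewrite -expr2 sqr_ge0.
Qed.

(** If the residual [r] of a maximizer [c] of the Rayleigh quotient were nonzero, moving from [c]
    along [r] would raise the quotient. *)
Lemma rayleigh_max n (S : 'M[R]_n) : (0 < n)%N -> S^T = S ->
  exists mu (v : 'rV[R]_n), [/\ v != 0, v *m S = mu *: v &
    forall w, dot (w *m S) w <= mu * dot w w].
Proof.
case: n S => // n S _ Ssym.
have cid j : continuous (fun v : 'rV[R]_n.+1 => v 0 j) by exact: coord_continuous.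
have cS j : continuous (fun v : 'rV[R]_n.+1 => (v *m S) 0 j).
  have -> : (fun v : 'rV[R]_n.+1 => (v *m S) 0 j) = (fun v => dot v (row j S^T)).
    by apply/funext => v; rewrite mxE; apply: eq_bigr => k _; rewrite !mxE.
  by apply: (continuous_dot cid) => k; exact: cst_continuous.
have [|c] := EVT_max_rV _ (@compact_sphere n.+1)
  (continuous_subspaceT (continuous_dot cS cid)).
  exists (delta_mx 0 0) => /=; rewrite /dot (bigD1 0)//= big1 ?mxE ?eqxx ?mulr1 ?addr0//.
  by move=> i /negPf i0; rewrite !mxE i0 andbF mulr0.
rewrite inE /= => c1 maxc.
set mu := dot (c *m S) c in maxc.
have bound w : dot (w *m S) w <= mu * dot w w.
  have [->|w0] := eqVneq w 0; first by rewrite mul0mx dot0l mulr0.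
  have ww : 0 < dot w w by rewrite lt_neqAle dot_ge0 eq_sym dot_eq0 w0.
  have e0 : enorm w != 0 by rewrite gt_eqF// sqrtr_gt0.
  have := maxc ((enorm w)^-1 *: w); rewrite inE /= -scalemxAl !(dotZl, dotZr).
  rewrite !mulrA -invfM -expr2 enorm_sqr mulVf ?gt_eqF// => /(_ erefl).
  by rewrite mulrC ler_pdivrMr.
exists mu, c; split=> //.
  by rewrite -dot_eq0 c1 oner_eq0.
apply/eqP; rewrite -subr_eq0 -dot_eq0; set r := c *m S - mu *: c.
have E : dot (c *m S) r - mu * dot c r = dot r r.
  by rewrite -dotZl -dotBl.
clearbody r.
have [//|rr] := eqVneq.
have {}rr : 0 < dot r r by rewrite lt_neqAle dot_ge0 eq_sym rr.
pose q := mu * dot r r - dot (r *m S) r.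
have q0 : 0 <= q by rewrite subr_ge0.
(* Small enough for the first-order gain [2 * t * dot r r] to exceed the second-order loss
   [t ^+ 2 * q]; adding [dot r r] covers [q = 0]. *)
pose t := dot r r / (q + dot r r).
have qr : 0 < q + dot r r by rewrite ltr_wpDl.
have t0 : 0 < t by rewrite divr_gt0.
have tq : t * q < 2 * dot r r.
  by rewrite /t mulrAC ltr_pdivrMr//; nra.
have := bound (c + t *: r).
rewrite mulmxDl -scalemxAl !(dotDl, dotDr, dotZl, dotZr) (dot_mulmx S r c) Ssym.
rewrite (dotC r (c *m S)) (dotC r c) -/mu c1.
suff : t * (2 * dot r r - t * q) > 0 by rewrite /q; nra.
by rewrite mulr_gt0// subr_gt0.
Qed.

(** Sylvester's determinant identity: the bordered matrix [B] is reduced by two block eliminations,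
    one leaving the n by n determinant, the other a triangular matrix. *)
Lemma char_poly_rank1 n (u : 'rV[R]_n) : dot u u = 1 ->
  'X * char_poly (u^T *m u) = 'X^n * ('X - 1).
Proof.
move=> u1; pose up := map_mx polyC u; pose v := up^T.
have uv : up *m v = 1%:M.
  by rewrite /v /up map_trmx -map_mxM; apply/matrixP => i j;
     rewrite !ord1 mxE dot_mulmxE u1 mxE.
pose B : 'M[{poly R}]_(n + 1) := block_mx ('X%:M) v up 1%:M.
have E1 : B = block_mx ('X%:M - v *m up) v 0 1%:M *m block_mx 1%:M 0 up 1%:M.
  by rewrite mulmx_block !mulmx1 !mul0mx !mul1mx !mulmx0 !add0r subrK.
have E2 : B *m block_mx 1%:M (- v) 0 ('X%:M) =
    block_mx ('X%:M) 0 up ('X%:M - 1%:M).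
  rewrite mulmx_block !mulmx1 !mulmx0 !addr0 !mul1mx !mulmxN uv.
  by rewrite mul_scalar_mx mul_mx_scalar addNr [X in block_mx _ _ _ X]addrC.
have := congr1 (@determinant _ _) E2.
rewrite det_mulmx {1}E1 det_mulmx !det_ublock !det_lblock !det1 !mulr1 !mul1r.
rewrite !det_scalar expr1 -raddfB det_mx11 [X in _ = _ * X -> _]mxE mulr1n => <-.
by rewrite mulrC /char_poly /char_poly_mx map_mxM -map_trmx.
Qed.

(* With J = u^T u, (X - S + J) (X - J) = X (X - S). *)
Lemma char_poly_deflate n (S : 'M[R]_n) (u : 'rV[R]_n) :
  S *m u^T = u^T -> dot u u = 1 ->
  char_poly (S - u^T *m u) * ('X - 1) = 'X * char_poly S.
Proof.
move=> Su u1; set J := u^T *m u.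
have SJ : S *m J = J by rewrite mulmxA Su.
have JJ : J *m J = J.
  rewrite {2}/J mulmxA -(mulmxA u^T) (_ : u *m u^T = 1%:M) ?mulmx1//.
  by apply/matrixP => i j; rewrite !ord1 dot_mulmxE u1 mxE.
have E : char_poly_mx (S - J) *m char_poly_mx J = 'X *: char_poly_mx S.
  rewrite /char_poly_mx map_mxB mulmxBr mul_mx_scalar !mulmxBl -!map_mxM SJ JJ.
  by rewrite subrr subr0 mul_scalar_mx -scalerBr opprB addrA addrAC addrK.
have := congr1 (@determinant _ _) E; rewrite det_mulmx detZ => E'.
have Xn0 : 'X^n != 0 :> {poly R} by rewrite monic_neq0 ?monicXn.
apply: (mulfI Xn0); rewrite mulrCA -(char_poly_rank1 u1) mulrCA.
by rewrite E' mulrCA.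
Qed.

Lemma count_mem_roots_with_mult (p : {poly R}) x : p != 0 ->
  count_mem x (roots_with_mult p) = mup x p.
Proof.
move=> p0; rewrite /roots_with_mult.
have mem y : (y \in rootsR p) = root p y.
  by rewrite -(roots_on_rootsR p0) in_itv.
have [xp|xp] := boolP (root p x); last first.
  rewrite mupNroot//; apply/count_memPn; apply/flattenP => -[s /mapP[y yp ->]].
  rewrite mem_nseq => /andP[_ /eqP xy]; move: yp xp.
  by rewrite mem xy => ->.
have : uniq (rootsR p) by exact: uniq_roots.
have : x \in rootsR p by rewrite mem.
elim: (rootsR p) => //= y s IH; rewrite inE count_cat count_nseq /=.
case: eqVneq => [->|yx] /= xs /andP[ys us].
  rewrite mul1n -[RHS]addn0; congr addn; apply/count_memPn.
  apply/flattenP => -[r /mapP[z zs ->]]; rewrite mem_nseq => /andP[_ /eqP yz].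
  by rewrite yz zs in ys.
by rewrite mul0n add0n IH.
Qed.

Lemma mem_roots_with_mult (p : {poly R}) x : p != 0 ->
  (x \in roots_with_mult p) = root p x.
Proof.
move=> p0; rewrite -has_pred1 has_count count_mem_roots_with_mult//.
by rewrite -XsubC_dvd// dvdp_XsubCl.
Qed.

Lemma sorted_second (l : seq R) : sorted >=%R l ->
  (forall y, y \in l -> 0 <= y /\ y <= 1) -> count_mem 1 l = 1%N ->
  0 <= l`_1 < 1 /\ (forall y, y \in l -> y != 1 -> y <= l`_1).
Proof.
have ge_trans : transitive (>=%R : rel R) by move=> a b c ab /le_trans; exact.
case: l => // a l /= ls lP l1.
have al : all (>=%R a) l by exact: order_path_min ls.
have a1 : a = 1.
  apply/eqP; rewrite eq_le (lP a (mem_head _ _)).2 /=.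
  have : 1 \in a :: l by rewrite -has_pred1 has_count /= l1.
  by rewrite inE => /predU1P[->//|/(allP al)].
move: l1 ls lP {al}; rewrite a1 eqxx add1n => -[].
case: l => [_ _ _|b l bl /= /andP[_ bs] lP] /=.
  (* In a list of length one, the entry of index 1 is the default 0, and no member differs from
     1. *)
  by rewrite lexx ltr01; split=> // y; rewrite inE => /eqP ->; rewrite eqxx.
have b1 : b != 1 by apply/eqP => b1; move: bl; rewrite /= b1 eqxx.
have /lP[b0 b1'] : b \in [:: 1, b & l] by rewrite !inE eqxx orbT.
rewrite b0 lt_neqAle b1 b1'; split=> // y; rewrite !inE.
case/or3P => [/eqP ->|/eqP -> //|yl]; first by rewrite eqxx.
by move=> _; exact: (allP (order_path_min ge_trans bs)).
Qed.

(* The maximum of the Rayleigh quotient of the deflated matrix S - u^T u is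
   either nonpositive or a root of char_poly S other than 1, and deflation shows
   that 1 is a simple root. *)
Lemma second_root_bound n (S : 'M[R]_n) (u : 'rV[R]_n)
    (l := sort >=%R [seq Num.sqrt x | x <- roots_with_mult (char_poly S)]) :
  S^T = S -> u *m S = u -> dot u u = 1 ->
  (forall v, 0 <= dot (v *m S) v) ->
  (forall v, v != 0 -> dot v u = 0 -> dot (v *m S) v < dot v v) ->
  0 <= l`_1 < 1 /\
  forall v, dot v u = 0 -> dot (v *m S) v <= l`_1 ^+ 2 * dot v v.
Proof.
move=> Ssym uS u1 S0 Slt.
have n0 : (0 < n)%N.
  case: n u u1 {S l Ssym uS S0 Slt} => // u; rewrite /dot big_ord0.
  by move/esym/eqP; rewrite oner_eq0.
have Su : S *m u^T = u^T by rewrite -{1}Ssym -trmx_mul uS.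
have cS0 : char_poly S != 0 by rewrite monic_neq0 ?char_poly_monic.
(* An eigenvector for an eigenvalue other than 1 is orthogonal to [u], where the quadratic form is
   strictly below the squared norm. *)
have evS x : root (char_poly S) x -> 0 <= x /\ (x = 1 \/ x < 1).
  rewrite -eigenvalue_root_char => /eigenvalueP[v vS v0].
  have vv : 0 < dot v v by rewrite lt_neqAle dot_ge0 eq_sym dot_eq0 v0.
  split; first by have := S0 v; rewrite vS dotZl pmulr_lge0.
  have : dot (v *m S) u = dot v u by rewrite dot_mulmx Ssym uS.
  rewrite vS dotZl => /eqP; rewrite -subr_eq0 -[X in _ - X]mul1r -mulrBl mulf_eq0.
  case/orP=> [|/eqP vu]; first by rewrite subr_eq0 => /eqP; left.
  by right; have := Slt v v0 vu; rewrite vS dotZl gtr_pMl.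
have Jv v : dot v u = 0 -> v *m (S - u^T *m u) = v *m S.
  move=> vu; rewrite mulmxBr mulmxA (_ : v *m u^T = 0) ?mul0mx ?subr0//.
  by apply/matrixP => i j; rewrite !ord1 dot_mulmxE vu mxE.
have uJ : (S - u^T *m u) *m u^T = 0.
  rewrite mulmxBl Su -mulmxA (_ : u *m u^T = 1%:M) ?mulmx1 ?subrr//.
  by apply/matrixP => i j; rewrite !ord1 dot_mulmxE u1 mxE.
have mup1 : mup 1 (char_poly S) = 1%N.
  rewrite -(@mupMr _ 1 ('X : {poly R})) ?rootX ?oner_eq0//.
  rewrite -(char_poly_deflate Su u1).
  rewrite mupMr; first by have := @mup_XsubCX R 1 1 1; rewrite expr1 eqxx.
  (* An eigenvector of the deflated matrix for 1 would be orthogonal to [u], hence fixed by [S],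
     against the strict bound. *)
  rewrite -eigenvalue_root_char; apply/negP => /eigenvalueP[v vS v0].
  have vu : dot v u = 0.
    have := congr1 (fun w => (w *m u^T) 0 0) vS.
    by rewrite -mulmxA uJ mulmx0 mxE scale1r dot_mulmxE.
  have := Slt v v0 vu; rewrite -Jv// vS scale1r ltxx.
  by [].
have memS x : (x \in roots_with_mult (char_poly S)) = root (char_poly S) x.
  exact: mem_roots_with_mult.
have lP y : y \in l -> 0 <= y /\ y <= 1.
  rewrite mem_sort => /mapP[x]; rewrite memS => /evS[x0 x1] ->.
  rewrite sqrtr_ge0; split=> //; rewrite -sqrtr1 ler_wsqrtr//.
  by case: x1 => [->//|/ltW].
have l1 : count_mem 1 l = 1%N.
  rewrite count_sort count_map -mup1 -count_mem_roots_with_mult//.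
  apply: eq_in_count => x; rewrite memS => /evS[x0 _] /=.
  apply/eqP/eqP => [x1|->]; last exact: sqrtr1.
  by rewrite -(sqr_sqrtr x0) x1 expr1n.
have ls : sorted >=%R l by apply: sort_sorted => x y; exact: le_total.
have [lb lmax] := sorted_second ls lP l1; split=> // v vu.
have [|mu [c [c0 cS bound]]] := @rayleigh_max n (S - u^T *m u) n0.
  by rewrite linearB /= trmx_mul trmxK Ssym.
have := bound v; rewrite Jv// => /le_trans; apply.
rewrite ler_wpM2r ?dot_ge0//; have [mu0|mu0] := leP mu 0.
  by rewrite (le_trans mu0) ?sqr_ge0.
(* The deflated matrix sends [u] to 0, so an eigenvector with [mu > 0] is orthogonal to [u]; thus
   [mu] is an eigenvalue of [S] other than 1. *)
have cu : dot c u = 0.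
  have := congr1 (fun w => (w *m u^T) 0 0) cS.
  rewrite -mulmxA uJ mulmx0 mxE -scalemxAl mxE dot_mulmxE => /esym/eqP.
  by rewrite mulf_eq0 gt_eqF//= => /eqP.
have mur : root (char_poly S) mu.
  rewrite -eigenvalue_root_char; apply/eigenvalueP; exists c => //.
  by rewrite -Jv.
have mu1 : mu < 1.
  have := Slt c c0 cu; rewrite -(Jv c cu) cS dotZl gtr_pMl//.
  by rewrite lt_neqAle dot_ge0 eq_sym dot_eq0 c0.
rewrite -(sqr_sqrtr (ltW mu0)) ler_pXn2r ?nnegrE ?sqrtr_ge0//; last first.
  by case/andP: lb.
by apply: lmax; [rewrite mem_sort map_f ?memS|rewrite lt_eqF// -sqrtr1 ltr_sqrt].
Qed.

End SymmetricMatrices.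

(** * Contraction of disagreement by the mixing matrix *)

Section Consensus.
Context {R : realType} {n : nat}.
Variables (E : rel 'I_n) (P : 'M[R]_n).
Hypotheses (hE : connected_graph E) (hPE : weight_matrix E P)
  (hP : doubly_stochastic_posdiag P) (n0 : (0 < n)%N).

Lemma row_sum1 i : \sum_j P i j = 1.
Proof.
have [/matrixP/(_ i 0) + _ _] := hP; rewrite !mxE => <-.
by apply: eq_bigr => j _; rewrite mxE mulr1.
Qed.

Lemma col_sum1 j : \sum_i P i j = 1.
Proof.
have [_ /matrixP/(_ 0 j) + _] := hP; rewrite !mxE => <-.
by apply: eq_bigr => i _; rewrite mxE mul1r.
Qed.

(** For each [i] the double sum is twice the variance of [w] under the probability vector in row [i]
    of [P]; the unit column sums then restore [dot w w]. *)
Lemma dirichlet_form (w : 'rV[R]_n) :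
  2 * (dot w w - dot (w *m P^T) (w *m P^T)) =
  \sum_i \sum_j \sum_k P i j * P i k * (w 0 j - w 0 k) ^+ 2.
Proof.
have E1 i : \sum_j \sum_k P i j * P i k * (w 0 j - w 0 k) ^+ 2 =
    2 * \sum_j P i j * (w 0 j) ^+ 2 - 2 * (\sum_j P i j * w 0 j) ^+ 2.
  transitivity (\sum_j (P i j * w 0 j ^+ 2 + P i j * \sum_k P i k * w 0 k ^+ 2
      - 2 * ((P i j * w 0 j) * \sum_k P i k * w 0 k))).
    apply: eq_bigr => j _.
    rewrite -[P i j * w 0 j ^+ 2]mulr1 -{1}(row_sum1 i) !mulr_sumr.
    rewrite -big_split -sumrB /=; apply: eq_bigr => k _; ring.
  rewrite sumrB big_split /= -mulr_suml row_sum1 -mulr_sumr -mulr_suml; ring.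
under [RHS]eq_bigr do rewrite E1.
rewrite sumrB -!mulr_sumr -mulrBr; congr (2 * (_ - _)).
  rewrite exchange_big /=; apply: eq_bigr => j _.
  by rewrite -mulr_suml col_sum1 mul1r expr2.
apply: eq_bigr => i _; rewrite -expr2; congr (_ ^+ 2).
by rewrite mxE; apply: eq_bigr => j _; rewrite mxE mulrC.
Qed.

Lemma dot_gram (v : 'rV[R]_n) :
  dot (v *m (P^T *m P)) v = dot (v *m P^T) (v *m P^T).
Proof. by rewrite mulmxA dot_mulmx. Qed.

(** Otherwise every term of the Dirichlet form vanishes. The term with indices [i], [i], [j], whose
    weight [P i i * P i j] is positive on edges thanks to the positive diagonal, forces equality
    along edges; connectedness makes [v] constant, and its zero sum makes it 0. *)
Lemma stochastic_strict_contraction (v : 'rV[R]_n) :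
  v != 0 -> \sum_j v 0 j = 0 -> dot (v *m P^T) (v *m P^T) < dot v v.
Proof.
move=> v0 sv; rewrite ltNge; apply/negP => h; case/eqP: v0.
have [P01 PE _] := hPE; have [_ _ Pd] := hP.
have T0 i j k : 0 <= P i j * P i k * (v 0 j - v 0 k) ^+ 2.
  rewrite mulr_ge0 ?sqr_ge0// mulr_ge0//; first by case/andP: (P01 i j).
  by case/andP: (P01 i k).
have D0 : \sum_i \sum_j \sum_k P i j * P i k * (v 0 j - v 0 k) ^+ 2 = 0.
  apply/eqP; rewrite eq_le; apply/andP; split.
    rewrite -dirichlet_form; lra.
  by apply: sumr_ge0 => i _; apply: sumr_ge0 => j _; apply: sumr_ge0.
have edge i j : E i j -> v 0 i = v 0 j.
  move=> /PE Pij.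
  move/eqP: D0; rewrite psumr_eq0 => [|k _]; last first.
    by apply: sumr_ge0 => j' _; apply: sumr_ge0.
  move=> /allP/(_ i (mem_index_enum _)) /=.
  rewrite psumr_eq0 => [|k _]; last by apply: sumr_ge0.
  move=> /allP/(_ i (mem_index_enum _)) /=.
  rewrite psumr_eq0 // => /allP/(_ j (mem_index_enum _)) /=.
  by rewrite mulf_eq0 sqrf_eq0 mulf_eq0 (gt_eqF (Pd i)) (gt_eqF Pij) subr_eq0 => /eqP.
have cst i j : v 0 i = v 0 j.
  have /connectP[p + ->] := hE.2 i j.
  elim: p i => //= k p IH i /andP[/edge -> ]; exact: IH.
apply/rowP => i; rewrite mxE.
have : \sum_(j < n) v 0 j = n%:R * v 0 i.
  rewrite (eq_bigr (fun=> v 0 i)) => [|j _]; last exact: cst.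
  by rewrite sumr_const card_ord mulr_natl.
rewrite sv => /esym/eqP; rewrite mulf_eq0 pnatr_eq0 => /predU1P[nE|/eqP//].
by move: (ltn_ord i); rewrite [X in (_ < X)%N]nE.
Qed.

(** The deflated direction [u] is the constant unit vector, whose orthogonal complement consists of
    the zero-sum vectors. *)
Lemma second_singular_value :
  let beta := (singular_values P)`_1 in
  0 <= beta < 1 /\
  forall v : 'rV[R]_n, \sum_j v 0 j = 0 ->
    dot (v *m P^T) (v *m P^T) <= beta ^+ 2 * dot v v.
Proof.
have [P1 P1' _] := hP.
move=> beta.
set c : R := (Num.sqrt n%:R)^-1; pose u : 'rV[R]_n := const_mx c.
have nR0 : (0 : R) < n%:R by rewrite ltr0n.
have c0 : c != 0 by rewrite invr_eq0 gt_eqF// sqrtr_gt0.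
have dotu (v : 'rV[R]_n) : dot v u = (\sum_j v 0 j) * c.
  by rewrite mulr_suml; apply: eq_bigr => j _; rewrite mxE.
have vu (v : 'rV[R]_n) : \sum_j v 0 j = 0 <-> dot v u = 0.
  rewrite dotu; split=> [->|/eqP]; first by rewrite mul0r.
  by rewrite mulf_eq0 (negPf c0) orbF => /eqP.
have [|||||lb bound] := @second_root_bound R n (P^T *m P) u.
- by rewrite trmx_mul trmxK.
- have -> : u = c *: const_mx 1 by apply/rowP => j; rewrite !mxE mulr1.
  rewrite -scalemxAl mulmxA -[const_mx 1]trmxK trmx_const -trmx_mul P1.
  by rewrite trmx_const P1'.
- rewrite dotu (eq_bigr (fun=> c)) => [|j _]; last by rewrite mxE.
  rewrite sumr_const card_ord -mulr_natl -mulrA -expr2 exprVn sqr_sqrtr ?ltW//.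
  by rewrite divff// gt_eqF.
- by move=> v; rewrite dot_gram dot_ge0.
- by move=> v v0 /vu sv; rewrite dot_gram stochastic_strict_contraction.
split=> // v /vu/bound; by rewrite dot_gram.
Qed.

(** Mixing acts on the [m] coordinates separately: the scalar bound holds for each and the squares
    add up. *)
Lemma stack_contraction m (W : 'I_n -> 'rV[R]_m) :
  \sum_i W i = 0 ->
  enorm (stack (fun i => \sum_j P i j *: W j)) <=
  (singular_values P)`_1 * enorm (stack W).
Proof.
move=> W0; have [/andP[b0 _] bound] := second_singular_value.
rewrite -ler_sqr ?nnegrE ?mulr_ge0 ?enorm_ge0// exprMn !enorm_sqr !dot_stack.
rewrite /dot exchange_big [in leRHS]exchange_big /= mulr_sumr.
apply: ler_sum => k _; pose v : 'rV[R]_n := \row_i W i 0 k.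
have /bound : \sum_j v 0 j = 0.
  transitivity ((\sum_i W i) 0 k); last by rewrite W0 mxE.
  by rewrite summxE; apply: eq_bigr => j _; rewrite mxE.
congr (_ <= _).
  apply: eq_bigr => i _; rewrite summxE mxE; congr (_ * _);
  by apply: eq_bigr => j _; rewrite !mxE mulrC.
by congr (_ * _); apply: eq_bigr => i _; rewrite !mxE.
Qed.

Lemma fmean_mix m (W : 'I_n -> 'rV[R]_m) :
  fmean (fun i => \sum_j P i j *: W j) = fmean W.
Proof.
congr (_ *: _); rewrite exchange_big /=; apply: eq_bigr => j _.
by rewrite -scaler_suml col_sum1 scale1r.
Qed.

Lemma mix_sub_fmean m (W : 'I_n -> 'rV[R]_m) i :
  \sum_j P i j *: (W j - fmean W) = \sum_j P i j *: W j - fmean W.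
Proof.
under eq_bigr do rewrite scalerBr.
by rewrite sumrB -scaler_suml row_sum1 scale1r.
Qed.

End Consensus.

(** * Spectral radius of the rate matrix *)

Section SpectralRadius.
Context {R : realType}.

Lemma max_in_sup (A : set R) r : A r -> ubound A r -> sup A = r.
Proof.
move=> Ar ubr; apply/eqP; rewrite eq_le; apply/andP; split.
  by apply: ge_sup => //; exists r.
by apply: ub_le_sup => //; exists r.
Qed.

Lemma eigenvalue_mx2 (F : fieldType) (A : 'M[F]_2) w :
  eigenvalue A w = ((w - A 0 0) * (w - A 1 1) == A 0 1 * A 1 0).
Proof.
rewrite eigenvalue_root_char /root /char_poly (expand_det_row _ 0).
rewrite !big_ord_recl big_ord0 /cofactor !det_mx11 !mxE /=.
have -> : lift 0 0 = 1 :> 'I_2 by exact: val_inj.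
have -> : lift 1 0 = 0 :> 'I_2 by exact: val_inj.
rewrite !mulr1n !mulr0n /bump /= !add0n expr0 expr1 !hornerE -[RHS]subr_eq0.
by rewrite /=; congr (_ == 0); rewrite (_ : ord0 = 0); [ring|exact: val_inj].
Qed.

(** Both eigenvalues are real, and the second fact is the characteristic equation at the larger one.
    What follows relies on these two facts rather than on the closed form. *)
Lemma spectral_radius_rate (a L b : R) : 0 <= a * L -> 0 <= b ->
  b <= spectral_radius (rate_matrix a L b) /\
  (spectral_radius (rate_matrix a L b) - b) ^+ 2 =
    a * L * b * (1 + spectral_radius (rate_matrix a L b)).
Proof.
move=> u0 b0; set u := a * L in u0 *.
have pos : 0 <= 4 * (u * b * (b + 1)).
  by rewrite mulr_ge0 ?ler0n// mulr_ge0 ?addr_ge0// mulr_ge0.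
(* Under the root is the discriminant, trace squared minus four times the determinant. *)
pose disc := Num.sqrt ((b * u) ^+ 2 + 4 * (u * b * (b + 1))).
have disc2 : disc ^+ 2 = (b * u) ^+ 2 + 4 * (u * b * (b + 1)).
  by rewrite sqr_sqrtr// addr_ge0 ?sqr_ge0.
have disc0 : 0 <= disc by exact: sqrtr_ge0.
have disc_bu : b * u <= disc.
  by rewrite -ler_sqr ?nnegrE ?(mulr_ge0 b0 u0)// disc2 lerDl.
pose r := (b * (2 + u) + disc) / 2; pose r' := (b * (2 + u) - disc) / 2.
have rb : b <= r by rewrite /r; nra.
have rr' : `|r'| <= r.
  by rewrite ler_norml /r /r'; apply/andP; split; nra.
have r0 : 0 <= r by exact: le_trans rb.
have eig (w : R[i]) : eigenvalue (map_mx (real_complex R) (rate_matrix a L b)) w =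
    ((w == r%:C) || (w == r'%:C))%C.
  rewrite eigenvalue_mx2 !mxE /= -/u -subr_eq0.
  rewrite -(subr_eq0 w) -(subr_eq0 w r'%:C%C) -mulf_eq0; congr (_ == 0).
  have s1 : (r%:C + r'%:C = b%:C + (b * (u + 1))%:C)%C.
    by rewrite -!rmorphD; congr (_%:C)%C; rewrite /r /r'; field.
  have s2 : (r%:C * r'%:C = b%:C * (b * (u + 1))%:C - b%:C * (u * (b + 1))%:C)%C.
    rewrite -!rmorphM -rmorphB; congr (_%:C)%C.
    have -> : r * r' = ((b * (2 + u)) ^+ 2 - disc ^+ 2) / 4 by rewrite /r /r'; field.
    by rewrite disc2; field.
  have -> : ((w - r%:C) * (w - r'%:C) =
      w ^+ 2 - (r%:C + r'%:C) * w + r%:C * r'%:C)%C by ring.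
  by rewrite s1 s2; ring.
suff rE : spectral_radius (rate_matrix a L b) = r.
  rewrite rE; split=> //.
  have -> : (r - b) ^+ 2 = (b * u + disc) ^+ 2 / 4 by rewrite /r; field.
  by rewrite sqrrD disc2 /r; field.
apply: max_in_sup => [|y /= [w]].
  exists (r%:C)%C => /=; first by rewrite eig eqxx.
  by rewrite expr0n addr0 sqrtr_sqr ger0_norm.
by rewrite eig => /orP[] /eqP -> <-;
  rewrite /= expr0n addr0 sqrtr_sqr ?(ger0_norm r0).
Qed.
End SpectralRadius.

(** * The scalar recursion, its gain and the step size *)

Section ScalarRecursion.
Context {R : realType}.
Implicit Types (b u r p q x y : R).

(** Weighted Cauchy-Schwarz [(x + y)^2 <= (p + q) (x^2 / p + y^2 / q)], with [x'] and [y'] replacing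
    the quotients so that a zero weight is allowed. *)
Lemma sqr_add_le x y p q x' y' : 0 <= p -> 0 <= q -> 0 <= x' -> 0 <= y' ->
  0 <= x -> 0 <= y ->
  x ^+ 2 <= p * x' -> y ^+ 2 <= q * y' ->
  (x + y) ^+ 2 <= (p + q) * (x' + y').
Proof.
move=> p0 q0 x0' y0' x0 y0 hx hy.
suff : 2 * (x * y) <= p * y' + q * x' by rewrite sqrrD; lra.
rewrite -ler_sqr ?nnegrE ?addr_ge0 ?mulr_ge0// ?ler0n//.
have h : (x * y) ^+ 2 <= (p * y') * (q * x').
  by rewrite exprMn; apply: le_trans (ler_pM _ _ hx hy) _; rewrite ?sqr_ge0//; lra.
have := sqr_ge0 (p * y' - q * x'); rewrite exprMn; nra.
Qed.

Lemma sqr_scale_le (c x p x' : R) : x ^+ 2 <= p * x' ->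
  (c * x) ^+ 2 <= (c * p) * (c * x').
Proof.
by move=> h; rewrite exprMn [leRHS]mulrACA -expr2 ler_wpM2l ?sqr_ge0.
Qed.

(* With [M] the matrix of the linear recursion, [p] and [q] are the entries of
   [(1 - M)^-1 e2]. Weighting Cauchy-Schwarz by [p] and [q] makes the squares
   satisfy the same recursion, which a row vector proportional to
   [e1 (1 - M)^-1] then sums up. *)
Lemma recursion_sum_sqr b u (A B eps : nat -> R) : 0 <= b < 1 -> 0 <= u ->
  let D := (1 - b) ^+ 2 - 2 * (u * b) in
  0 < D -> A 0%N = 0 ->
  (forall t, 0 <= A t) -> (forall t, 0 <= B t) -> (forall t, 0 <= eps t) ->
  (forall t, A t.+1 <= b * (A t + B t)) ->
  (forall t, B t.+1 <= u * (1 + b) * A t + b * (1 + u) * B t + eps t) ->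
  forall t, \sum_(0 <= k < t.+1) A k ^+ 2 <=
    (b / D) ^+ 2 * (B 0%N ^+ 2 + \sum_(0 <= k < t) eps k ^+ 2).
Proof.
move=> /andP[b0 b1] u0 D D0 A0 Age Bge ege hA hB.
pose p := b / D; pose q := (1 - b) / D; pose l := (1 - b - u * b) / D.
have ub : 0 <= u * b by rewrite mulr_ge0.
have p0 : 0 <= p by rewrite divr_ge0// ltW.
have q1 : 1 <= q by rewrite ler_pdivlMr// /D; nra.
have l1 : 1 <= l by rewrite ler_pdivlMr// /D; nra.
have D0' : D != 0 by rewrite gt_eqF.
(* [pE] and [qE] read [M (p, q) + e2 = (p, q)]; [lE] and [lE'] read [(l, p) M = (l, p) - e1]. *)
have pE : b * (p + q) = p by rewrite /p /q; field.
have qE : u * (1 + b) * p + b * (1 + u) * q + 1 = q by rewrite /p /q /D; field.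
have lE : l * b + p * (u * (1 + b)) = l - 1 by rewrite /p /l /D; field.
have lE' : l * b + p * (b * (1 + u)) = p by rewrite /p /l /D; field.
(* [al] and [be] majorize [A^2 / p] and [B^2 / q] without a division, [p] being 0 when [b] is. *)
have H t : exists al be, [/\ 0 <= al, 0 <= be, A t ^+ 2 <= p * al,
    B t ^+ 2 <= q * be & \sum_(0 <= k < t) A k ^+ 2 + p * (l * al + p * be) <=
    p ^+ 2 * (B 0%N ^+ 2 + \sum_(0 <= k < t) eps k ^+ 2)].
  elim: t => [|t [al [be [al0 be0 hal hbe hs]]]].
    exists 0, (B 0%N ^+ 2); rewrite !big_nil sqr_ge0 A0 expr0n !mulr0 !add0r addr0.
    by split=> //; [rewrite ler_peMl ?sqr_ge0|rewrite mulrA -expr2].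
  have q0 : 0 <= q by lra.
  exists (b * (al + be)), (u * (1 + b) * al + b * (1 + u) * be + eps t ^+ 2).
  have c1 : 0 <= u * (1 + b) by rewrite mulr_ge0// addr_ge0.
  have c2 : 0 <= b * (1 + u) by rewrite mulr_ge0// addr_ge0.
  split.
  - by rewrite mulr_ge0 ?addr_ge0.
  - by rewrite !addr_ge0 ?mulr_ge0 ?sqr_ge0 ?addr_ge0.
  - apply: le_trans (_ : (b * (A t + B t)) ^+ 2 <= _).
      by rewrite ler_sqr ?nnegrE ?mulr_ge0 ?addr_ge0.
    rewrite -{1}pE; by apply: sqr_scale_le; apply: sqr_add_le.
  - apply: le_trans (_ : (u * (1 + b) * A t + b * (1 + u) * B t + eps t) ^+ 2 <= _).
      by rewrite ler_sqr ?nnegrE ?addr_ge0 ?mulr_ge0 ?addr_ge0.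
    have m1 := mulr_ge0 c1 p0; have m2 := mulr_ge0 c2 q0.
    have m3 := mulr_ge0 c1 al0; have m4 := mulr_ge0 c2 be0.
    have m5 := mulr_ge0 c1 (Age t); have m6 := mulr_ge0 c2 (Bge t).
    rewrite -{1}qE; apply: sqr_add_le;
      rewrite ?ler01 ?sqr_ge0 ?(addr_ge0 m1) ?(addr_ge0 m3) ?(addr_ge0 m5)//.
      by apply: sqr_add_le => //; exact: sqr_scale_le.
    by rewrite mul1r.
  rewrite !big_nat_recr//= [X in _ <= p ^+ 2 * X]addrA [leRHS]mulrDr.
  have -> : l * (b * (al + be)) +
     p * (u * (1 + b) * al + b * (1 + u) * be + eps t ^+ 2) =
    (l * b + p * (u * (1 + b))) * al + (l * b + p * (b * (1 + u))) * be +
      p * eps t ^+ 2 by ring.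
  rewrite lE lE'; nra.
move=> t; have [al [be [al0 be0 hal hbe hs]]] := H t.
rewrite big_nat_recr//=; apply: le_trans hs; rewrite lerD2l.
apply: le_trans hal _; rewrite ler_wpM2l//.
have := mulr_ge0 p0 be0; nra.
Qed.

(** The last hypothesis concerns the value at 1 of the characteristic polynomial
    [(r - b)^2 - u b (1 + r)], which increases beyond 1 since [u * b <= 1 - b]. *)
Lemma rate_lt1 b u r : 0 <= b -> b < 1 -> 0 < u -> b <= r ->
  (r - b) ^+ 2 = u * b * (1 + r) -> 0 < (1 - b) ^+ 2 - 2 * (u * b) -> r < 1.
Proof.
move=> b0 b1 u0 br rE D0.
have ub : 0 <= u * b by rewrite mulr_ge0// ltW.
have h : u * b <= 1 - b.
  have : (1 - b) ^+ 2 <= 1 - b by rewrite expr2 ler_piMl//; lra.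
  lra.
rewrite ltNge; apply/negP => r1.
have : (r - b) ^+ 2 = (1 - b) ^+ 2 + (r - 1) * (r - 1 + 2 * (1 - b)) by ring.
have : 0 <= (r - 1) * (r - 1 + (1 - b)) by rewrite mulr_ge0; lra.
have : 0 <= (r - 1) * ((1 - b) - u * b) by rewrite mulr_ge0; lra.
rewrite rE; nra.
Qed.

(** By the equation for [r], the claim becomes [9 q g^2 <= 8 (1 - r) F^2], with [g = r - b] and
    [q = u b]. It follows from [3 g <= 2 F] and [8 q <= 9 (1 - r)], the latter a consequence of the
    step-size condition. *)
Lemma gain_le b u r : 0 <= b -> b < 1 -> 0 < u -> b <= r ->
  (r - b) ^+ 2 = u * b * (1 + r) ->
  let D := (1 - b) ^+ 2 - 2 * (u * b) in 0 < D ->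
  1 > 2 * u * (1 + 8 / (9 * (1 - r ^+ 2))) ->
  (u * (b / D)) ^+ 2 <= 8 / (9 * (1 - r ^+ 2)).
Proof.
move=> b0 b1 u0 br rE D D0 hu.
have r1 : r < 1 by exact: rate_lt1 D0.
 have r0 : 0 <= r by exact: le_trans br.
have w0 : 0 < 1 - r ^+ 2 by nra.
have {hu} hu : 16 * u <= 9 * (1 - r ^+ 2).
  have : 2 * u * (8 / (9 * (1 - r ^+ 2))) < 1.
    by move: hu; rewrite mulrDr mulr1; nra.
  by rewrite mulrA ltr_pdivrMr ?mulr_gt0// mul1r; nra.
set g := r - b in rE; set q := u * b in rE.
have g0 : 0 <= g by rewrite subr_ge0.
have q0 : 0 <= q by rewrite mulr_ge0// ltW.
(* [F] is 1 minus the other eigenvalue, so [(1 - r) * F] is the determinant of 1 - M. *)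
pose F := 1 + r - 2 * b - q.
have DE : D = (1 - r) * F.
  have : b = r - g by rewrite /g; ring.
  move=> bE; rewrite /D -/q /F.
  have : (1 - b) ^+ 2 - 2 * q - (1 - r) * (1 + r - 2 * b - q) = g ^+ 2 - q * (1 + r).
    by rewrite bE; ring.
  by rewrite rE; lra.
have qg : 2 * q <= g.
  have : g <= r by rewrite /g; lra.
  nra.
have Fg : 3 * g <= 2 * F by rewrite /F /g in qg *; lra.
have hq : 16 * q <= 9 * ((1 - r) * (1 + r)) by rewrite /q; nra.
rewrite mulrA -/q expr_div_n ler_pdivrMr ?exprn_gt0// mulrAC.
rewrite ler_pdivlMr ?mulr_gt0// DE.
have -> : q ^+ 2 * (9 * (1 - r ^+ 2)) = 9 * (1 - r) * q * (q * (1 + r)) by ring.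
rewrite -rE.
have -> : 8 * ((1 - r) * F) ^+ 2 = (1 - r) * (8 * (1 - r) * F ^+ 2) by ring.
have -> : 9 * (1 - r) * q * g ^+ 2 = (1 - r) * (9 * q * g ^+ 2) by ring.
rewrite ler_wpM2l//; first lra.
have : 9 * g ^+ 2 <= 4 * F ^+ 2.
  by have := lerXn2r 2 _ _ Fg; rewrite !nnegrE !exprMn; nra.
have : 16 * (q * g ^+ 2) <= 9 * ((1 - r) * 2) * g ^+ 2 by nra.
have : 0 <= F ^+ 2 by exact: sqr_ge0.
nra.
Qed.

End ScalarRecursion.

(** The mean of the squares is the square of the mean plus a variance. *)
Lemma enorm_run_avg_sqr {R : realType} m (u : nat -> 'rV[R]_m) t : (0 < t)%N ->
  enorm (run_avg u t) ^+ 2 <= t%:R^-1 * \sum_(0 <= k < t) enorm (u k.+1) ^+ 2.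
Proof.
move=> t0; have tR0 : (0 : R) < t%:R by rewrite ltr0n.
rewrite -(ler_pM2l tR0) mulVKf ?gt_eqF//.
set w := run_avg u t.
have E k : enorm (u k.+1) ^+ 2 = enorm (u k.+1 - w) ^+ 2 +
    (2 * dot (u k.+1) w - dot w w).
  by rewrite !enorm_sqr !(dotDl, dotDr, dotNl, dotNr) (dotC w); ring.
under [leRHS]eq_bigr do rewrite E.
rewrite big_split sumrB /= -mulr_sumr -dot_suml sumr_const_nat subn0.
have -> : \sum_(0 <= k < t) u k.+1 = t%:R *: w.
  by rewrite scalerA divff ?gt_eqF// scale1r big_add1.
have : 0 <= \sum_(0 <= k < t) enorm (u k.+1 - w) ^+ 2.
  by apply: sumr_ge0 => k _; exact: sqr_ge0.
rewrite dotZl enorm_sqr -mulr_natl; lra.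
Qed.

(** * Consensus errors and dual averaging along a run *)

Section DualAveraging.
Context {R : realType} {n m : nat} (X : set 'rV[R]_m) (f : 'I_n -> 'rV[R]_m -> R)
  (L : R) (E : rel 'I_n) (P : 'M[R]_n) (d : 'rV[R]_m -> R) (x0 : 'rV[R]_m) (a : R)
  (x z s : nat -> 'I_n -> 'rV[R]_m) (y : nat -> 'rV[R]_m).
Hypotheses (n0 : (0 < n)%N)
  (hXconv : convex_set (X : set (convex_lmodType 'rV[R]_m)))
  (hXcomp : compact X) (hL : 0 < L)
  (hfconv : forall i, diff_convex_on X (f i))
  (hflip : forall i, lipschitz_grad_on L X (f i))
  (hE : connected_graph E)
  (hPE : weight_matrix E P) (hP : doubly_stochastic_posdiag P)
  (hddiff : differentiable_on X d) (hdconv : strongly_convex_on 1 X d)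
  (hx0 : is_argmin_on X d x0) (hdx0 : d x0 = 0) (ha : 0 < a)
  (hdda : dda_run X f P d a x0 x z s) (hy0 : y 0%N = x0)
  (hy : forall t, (1 <= t)%N ->
     y t = grad_conj X d (- (a *: (n%:R^-1 *: \sum_(i < n) z t i)))).

Let g t i := grad (f i) (x t i).
Let A t := enorm (stack (fun i => z t i - fmean (z t))).
Let B t := enorm (stack (fun i => s t i - fmean (s t))).
Let dy t := enorm (y t.+1 - y t).
Let pi2 := \sum_(i < n)
    enorm (grad (f i) x0 - n%:R^-1 *: \sum_(j < n) grad (f j) x0) ^+ 2.

Let nR0 : (0 : R) < n%:R. Proof. by rewrite ltr0n. Qed.

(** Gradient tracking: mixing preserves the mean of [s], and the increments added to it
    telescope. *)
Lemma fmean_s t : fmean (s t) = fmean (g t).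
Proof.
elim: t => [|t IH].
  by congr (_ *: _); apply: eq_bigr => i _; rewrite (dda_s0 hdda) /g (dda_x0 hdda).
have -> : s t.+1 = fun i => \sum_(j < n) P i j *: s t j + (g t.+1 i - g t i).
  by apply/funext => i; rewrite (dda_s hdda) addrA.
rewrite fmeanD (fmean_mix hP) IH.
by rewrite /fmean sumrB scalerBr addrCA subrr addr0.
Qed.

Lemma fmean_zS t : fmean (z t.+1) = fmean (z t) + fmean (g t).
Proof.
have -> : z t.+1 = fun i => \sum_(j < n) P i j *: (z t j + s t j).
  by apply/funext => i; rewrite (dda_z hdda).
by rewrite (fmean_mix hP) fmeanD fmean_s.
Qed.

Lemma z0E : z 0%N = fun=> 0.
Proof. by apply/funext => i; rewrite (dda_z0 hdda). Qed.

Lemma fmean_z t : fmean (z t) = \sum_(0 <= k < t) fmean (g k).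
Proof.
elim: t => [|t IH]; last by rewrite fmean_zS IH big_nat_recr.
by rewrite big_nil /fmean z0E big1 ?scaler0.
Qed.

(** Brings time 0 under the prox rule of the later steps, with dual variable 0. *)
Lemma argmax_x0 : is_argmax_on X (fun w => dot (- (a *: 0)) w - d w) x0.
Proof.
have [Xx0 minx0] := hx0; split=> // w Xw.
by rewrite scaler0 oppr0 !dot0l !sub0r lerN2 minx0.
Qed.

Let X_neq0 : X !=set0. Proof. by exists x0; case: hx0. Qed.

Lemma y_argmax t :
  is_argmax_on X (fun w => dot (- (a *: fmean (z t))) w - d w) (y t).
Proof.
case: t => [|t]; last by rewrite hy//; exact: grad_conjP.
rewrite hy0 fmean_z big_nil; exact: argmax_x0.
Qed.

Lemma x_argmax t i :
  is_argmax_on X (fun w => dot (- (a *: z t i)) w - d w) (x t i).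
Proof.
case: t => [|t]; last by rewrite (dda_x hdda); exact: grad_conjP.
rewrite (dda_x0 hdda) (dda_z0 hdda); exact: argmax_x0.
Qed.

Lemma y_in t : X (y t). Proof. by case: (y_argmax t). Qed.
Lemma x_in t i : X (x t i). Proof. by case: (x_argmax t i). Qed.

Lemma enorm_x_sub_y t :
  enorm (stack (fun i => x t i - y t)) <= a * A t.
Proof.
apply: enorm_stack_le => [|i]; first exact: ltW.
apply: le_trans (argmax_lipschitz hXconv hdconv (x_argmax t i) (y_argmax t)) _.
by rewrite -opprD enormN -scalerBr enormZ gtr0_norm.
Qed.

Lemma A_step t : A t.+1 <= (singular_values P)`_1 * (A t + B t).
Proof.
have W0 : \sum_i (z t i + s t i - (fmean (z t) + fmean (s t))) = 0.
  by rewrite -fmeanD sum_sub_fmean.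
apply: le_trans (_ : (singular_values P)`_1 *
    enorm (stack (fun i => z t i + s t i - (fmean (z t) + fmean (s t)))) <= _).
  rewrite /A; have -> : (fun i => z t.+1 i - fmean (z t.+1)) = (fun i =>
      \sum_j P i j *: (z t j + s t j - (fmean (z t) + fmean (s t)))).
    apply/funext => i; rewrite (dda_z hdda) fmean_zS -fmean_s -fmeanD.
    by rewrite (mix_sub_fmean hP).
  exact: stack_contraction hE hPE hP n0 _ _ W0.
have [/andP[b0 _] _] := second_singular_value hE hPE hP n0.
rewrite ler_wpM2l//; apply: le_trans _ (ler_enormD _ _); rewrite -stackD.
rewrite le_eqVlt; apply/orP; left; apply/eqP; congr (enorm (stack _)).
by apply/funext => i; rewrite opprD addrACA.
Qed.

(** The move of [x] is split at [y]: two deviations bounded by [a * A], and a displacement common to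
    all agents, whose stacked norm carries the factor [Num.sqrt n%:R]. *)
Lemma stack_grad_diff_le t :
  enorm (stack (fun i => g t.+1 i - g t i)) <=
  L * (a * A t.+1 + a * A t + Num.sqrt n%:R * dy t).
Proof.
apply: le_trans (_ : L * enorm (stack (fun i => x t.+1 i - x t i)) <= _).
  by apply: enorm_stack_le => [|i]; [exact: ltW|apply: hflip; exact: x_in].
rewrite ler_pM2l//.
have -> : (fun i => x t.+1 i - x t i) = (fun i =>
    (x t.+1 i - y t.+1) + (-1 *: (x t i - y t)) + (y t.+1 - y t)).
  by apply/funext => i; apply/rowP => j; rewrite !mxE; ring.
rewrite stackD; apply: le_trans (ler_enormD _ _) _; apply: lerD; last first.
  by rewrite enorm_stack_cst.
rewrite stackD; apply: le_trans (ler_enormD _ _) _; apply: lerD.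
  exact: enorm_x_sub_y.
apply: le_trans _ (enorm_x_sub_y t); rewrite -[leRHS]mul1r.
by apply: enorm_stack_le => // i; rewrite enormZ normrN1.
Qed.

(** Eliminating [A t.+1] with [A_step] produces the second row of the rate matrix. *)
Lemma B_step t (b := (singular_values P)`_1) :
  B t.+1 <= a * L * (1 + b) * A t + b * (1 + a * L) * B t +
    L * Num.sqrt n%:R * dy t.
Proof.
have sS i : s t.+1 i - fmean (s t.+1) =
    \sum_j P i j *: (s t j - fmean (s t)) +
    (g t.+1 i - g t i - fmean (fun i => g t.+1 i - g t i)).
  rewrite (mix_sub_fmean hP) (dda_s hdda) !fmean_s.
  have -> : fmean (fun i => g t.+1 i - g t i) = fmean (g t.+1) - fmean (g t).
    by rewrite /fmean sumrB scalerBr.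
  by apply/rowP => j; rewrite !mxE /g; ring.
have -> : B t.+1 = enorm (stack (fun i => \sum_j P i j *: (s t j - fmean (s t)) +
    (g t.+1 i - g t i - fmean (fun i => g t.+1 i - g t i)))).
  by congr (enorm (stack _)); apply/funext.
have h1 : enorm (stack (fun i => \sum_j P i j *: (s t j - fmean (s t)))) <= b * B t.
  exact: stack_contraction hE hPE hP n0 _ _ (sum_sub_fmean _ n0).
have h2 := enorm_stack_sub_fmean (fun i => g t.+1 i - g t i) n0.
have h3 := stack_grad_diff_le t.
have h4 : L * (a * A t.+1) <= L * (a * (b * (A t + B t))).
  by rewrite !ler_pM2l// A_step.
rewrite stackD; apply: le_trans (ler_enormD _ _) _.
apply: le_trans (lerD h1 (le_trans h2 h3)) _; lra.
Qed.

Lemma B0_sqr : B 0%N ^+ 2 = pi2.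
Proof.
rewrite enorm_stack_sqr; apply: eq_bigr => i _; rewrite fmean_s (dda_s0 hdda).
congr (enorm (_ - _ *: _) ^+ 2); apply: eq_bigr => j _.
by rewrite /g (dda_x0 hdda).
Qed.

(** The recursion has input [L * Num.sqrt n%:R * dy] and output [a * A], so its gain acquires the
    factor [a * L], squared in [K]. *)
Lemma consensus_error_sum (b := (singular_values P)`_1)
    (K := (a * L * (b / ((1 - b) ^+ 2 - 2 * (a * L * b)))) ^+ 2) t :
  0 < (1 - b) ^+ 2 - 2 * (a * L * b) ->
  \sum_(0 <= k < t.+1) \sum_i enorm (x k i - y k) ^+ 2 <=
  K * (pi2 / L ^+ 2 + n%:R * \sum_(0 <= k < t) dy k ^+ 2).
Proof.
move=> D0; have [b01 _] := second_singular_value hE hPE hP n0.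
have aL0 : 0 <= a * L by rewrite mulr_ge0 ?ltW.
apply: le_trans (_ : a ^+ 2 * \sum_(0 <= k < t.+1) A k ^+ 2 <= _).
  rewrite mulr_sumr; apply: ler_sum => k _.
  rewrite -enorm_stack_sqr -exprMn ler_sqr ?nnegrE ?enorm_ge0 ?enorm_x_sub_y//.
  by rewrite mulr_ge0 ?enorm_ge0// ltW.
have A0 : A 0%N = 0.
  rewrite /A (_ : (fun _ => _) = fun=> 0) ?enorm_stack_cst ?enorm0 ?mulr0//.
  by apply/funext => i; rewrite fmean_z big_nil subr0 z0E.
have := @recursion_sum_sqr R b (a * L) A B (fun k => L * Num.sqrt n%:R * dy k)
  b01 aL0 D0 A0 _ _ _ A_step B_step t.
move=> /(_ _ _ _)/(ler_wpM2l (sqr_ge0 a)) h; apply: le_trans (h _ _ _) _ => [k|k|k|].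
- exact: enorm_ge0.
- exact: enorm_ge0.
- by rewrite !mulr_ge0 ?sqrtr_ge0 ?enorm_ge0// ltW.
rewrite B0_sqr.
under eq_bigr do rewrite !exprMn (sqr_sqrtr (ltW nR0)).
rewrite -mulr_sumr /K le_eqVlt; apply/orP; left; apply/eqP.
by field; rewrite !gt_eqF.
Qed.

(** The minimum over [X] of [a * dot (fmean (z t)) w + d w], attained at [y t], grows per step by at
    least the next summand of [H], by strong convexity. Pairing each gradient with the next iterate
    puts the squared increments on the left. *)
Lemma dual_averaging w t : X w ->
  \sum_(0 <= k < t) (a * dot (fmean (g k)) (y k.+1 - w) + 2^-1 * dy k ^+ 2) <= d w.
Proof.
move=> Xw.
have H : \sum_(0 <= k < t) (a * dot (fmean (g k)) (y k.+1) + 2^-1 * dy k ^+ 2) <=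
    a * dot (fmean (z t)) (y t) + d (y t).
  elim: t => [|t IH].
    by rewrite !big_nil fmean_z big_nil dot0l mulr0 add0r hy0 hdx0.
  rewrite big_nat_recr//=; have := argmax_strong hXconv hdconv (y_argmax t) (y_in t.+1).
  rewrite !dotNl !(dotZl a) fmean_zS dotDl -/(dy t); lra.
have [_ /(_ w Xw)] := y_argmax t; rewrite !dotNl !(dotZl a) => h.
under eq_bigr do rewrite dotBr mulrBr addrAC.
rewrite sumrB -mulr_sumr -dot_suml -fmean_z; lra.
Qed.

(** Descent from [x t i] to [y t.+1] is combined with convexity between [x t i] and [w]. Splitting
    [y t.+1 - x t i] at [y t] doubles the constant [L / 2]. *)
Lemma favg_step w t : X w ->
  favg f (y t.+1) - favg f w <= dot (fmean (g t)) (y t.+1 - w) +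
    L * dy t ^+ 2 + L / n%:R * \sum_i enorm (x t i - y t) ^+ 2.
Proof.
move=> Xw; have h i : f i (y t.+1) - f i w <= dot (g t i) (y t.+1 - w) +
    (L * dy t ^+ 2 + L * enorm (x t i - y t) ^+ 2).
  have := lipschitz_grad_descent hXconv (ltW hL) (hfconv i) (hflip i)
    (x_in t i) (y_in t.+1).
  have := hfconv i Xw (x_in t i); rewrite -/(g t i).
  have := enorm_sqrD_le (y t.+1 - y t) (y t - x t i).
  rewrite addrA subrK -/(dy t) (enormBC (y t)) => /(ler_wpM2l (ltW hL)).
  rewrite !dotBr; lra.
rewrite -mulrBr -sumrB; apply: le_trans (ler_wpM2l _ (ler_sum _ (fun i _ => h i))) _.
  by rewrite invr_ge0 ltW.
rewrite !big_split /= -dot_suml -mulr_sumr sumr_const.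
rewrite -[X in _ * (_ + (_ + X)) <= _]mulr_sumr card_ord dotZl.
rewrite le_eqVlt; apply/orP; left; apply/eqP.
by rewrite -(mulr_natl (dy t ^+ 2)); field; rewrite gt_eqF.
Qed.

(** Of the coefficient 1/2 of the squared increments supplied by dual averaging, descent consumes
    [a * L] and the consensus error [a * L * K]. *)
Lemma lyapunov_sum w t (K : R) : X w -> 0 <= K ->
  (forall t, \sum_(0 <= k < t.+1) \sum_i enorm (x k i - y k) ^+ 2 <=
     K * (pi2 / L ^+ 2 + n%:R * \sum_(0 <= k < t) dy k ^+ 2)) ->
  a * \sum_(0 <= k < t) (favg f (y k.+1) - favg f w) +
    (2^-1 - a * L - a * L * K) * \sum_(0 <= k < t) dy k ^+ 2 <=
  d w + a * K * pi2 / (n%:R * L).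
Proof.
move=> Xw K0 hK.
have aL0 : 0 <= a * (L / n%:R) by rewrite mulr_ge0 ?divr_ge0// ltW.
(* The consensus bound reaches time [t] with increments only before [t]; here the error at time [t]
   is dropped. *)
have h1 : \sum_(0 <= k < t) \sum_i enorm (x k i - y k) ^+ 2 <=
    K * (pi2 / L ^+ 2 + n%:R * \sum_(0 <= k < t) dy k ^+ 2).
  apply: le_trans _ (hK t); rewrite big_nat_recr//= lerDl.
  by apply: sumr_ge0 => i _; exact: sqr_ge0.
have h2 := dual_averaging t Xw.
have h3 : a * \sum_(0 <= k < t) (favg f (y k.+1) - favg f w) <=
    a * \sum_(0 <= k < t) dot (fmean (g k)) (y k.+1 - w) +
    a * L * (\sum_(0 <= k < t) dy k ^+ 2) +
    a * (L / n%:R) * \sum_(0 <= k < t) \sum_i enorm (x k i - y k) ^+ 2.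
  rewrite !mulr_sumr -!big_split /=; apply: ler_sum => k _.
  by rewrite -!mulrA -!mulrDr ler_pM2l// mulrA favg_step.
move: h2; rewrite big_split /= -!mulr_sumr => h2.
have := ler_wpM2l aL0 h1.
have -> : a * (L / n%:R) * (K * (pi2 / L ^+ 2 + n%:R * \sum_(0 <= k < t) dy k ^+ 2)) =
  a * K * pi2 / (n%:R * L) + a * L * K * \sum_(0 <= k < t) dy k ^+ 2.
  by field; rewrite !gt_eqF.
lra.
Qed.

Lemma favg_run_avg_le t : (0 < t)%N ->
  favg f (run_avg y t) <= t%:R^-1 * \sum_(0 <= k < t) favg f (y k.+1).
Proof.
move=> t0.
rewrite -mulr_sumr exchange_big /= mulrCA ler_pM2l ?invr_gt0//.
rewrite mulr_sumr; apply: ler_sum => i _.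
have := diff_convex_run_avg hXconv (hfconv i) (fun k => y_in k.+1) t0.
by rewrite big_add1.
Qed.

End DualAveraging.

Theorem theorem1 (R : realType) (n m : nat) (hn : (2 <= n)%N)
  (X : set 'rV[R]_m)
  (hXconv : convex_set (X : set (convex_lmodType 'rV[R]_m)))
  (hXcomp : compact X)
  (f : 'I_n -> 'rV[R]_m -> R) (L : R) (hL : 0 < L)
  (hfC1 : forall i, cont_differentiable_on X (f i))
  (hfconv : forall i, diff_convex_on X (f i))
  (hflip : forall i, lipschitz_grad_on L X (f i))
  (xstar : 'rV[R]_m) (hxstar : is_argmin_on X (favg f) xstar)
  (E : rel 'I_n) (hE : connected_graph E)
  (P : 'M[R]_n) (hPE : weight_matrix E P) (hP : doubly_stochastic_posdiag P)
  (d : 'rV[R]_m -> R) (hddiff : differentiable_on X d)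
  (hdconv : strongly_convex_on 1 X d)
  (x0 : 'rV[R]_m) (hx0 : is_argmin_on X d x0) (hdx0 : d x0 = 0)
  (a : R) (ha : 0 < a)
  (x z s : nat -> 'I_n -> 'rV[R]_m) (hdda : dda_run X f P d a x0 x z s)
  (y : nat -> 'rV[R]_m) (hy0 : y 0%N = x0)
  (hy : forall t, (1 <= t)%N ->
     y t = grad_conj X d (- (a *: (n%:R^-1 *: \sum_(i < n) z t i)))) :
  let beta := (singular_values P)`_1 in
  let rho := spectral_radius (rate_matrix a L beta) in
  let ytilde := run_avg y in
  let xtilde i := run_avg (fun t => x t i) in
  let pi2 := \sum_(i < n)
    enorm (grad (f i) x0 - n%:R^-1 *: \sum_(j < n) grad (f j) x0) ^+ 2 in
  let C := d xstar + 8 * a * pi2 / (9 * n%:R * L * (1 - rho ^+ 2)) in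
  let gamma := 2^-1 - a * L - 8 * a * L / (9 * (1 - rho ^+ 2)) in
  let D := 8 * n%:R * C / (9 * gamma * (1 - rho) ^+ 2)
           + 8 * pi2 / (9 * L ^+ 2 * (1 - rho ^+ 2)) in
  a^-1 > 2 * L * Num.max (beta / (1 - beta) ^+ 2)
                         (1 + 8 / (9 * (1 - rho ^+ 2))) ->
  (forall t, (1 <= t)%N ->
     favg f (ytilde t) - favg f xstar <= C / (a * t%:R)) /\
  (forall t i, (1 <= t)%N ->
     enorm (xtilde i t - ytilde t) ^+ 2 <= D / t%:R).
Proof.
move=> beta rho ytilde xtilde pi2 C gamma D hstep.
have n0 : (0 < n)%N by exact: ltnW.
have nR0 : (0 : R) < n%:R by rewrite ltr0n.
have [/andP[b0 b1] _] := second_singular_value hE hPE hP n0.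
rewrite -/beta in b0 b1.
have u0 : 0 < a * L by rewrite mulr_gt0.
have [br rE] := spectral_radius_rate (ltW u0) b0.
rewrite -/rho in br rE.
have Vb : beta / (1 - beta) ^+ 2 <= Num.max (beta / (1 - beta) ^+ 2)
    (1 + 8 / (9 * (1 - rho ^+ 2))) by rewrite le_max lexx.
have Vr : 1 + 8 / (9 * (1 - rho ^+ 2)) <= Num.max (beta / (1 - beta) ^+ 2)
    (1 + 8 / (9 * (1 - rho ^+ 2))) by rewrite le_max lexx orbT.
have step V : V <= Num.max (beta / (1 - beta) ^+ 2)
    (1 + 8 / (9 * (1 - rho ^+ 2))) -> 2 * (a * L) * V < 1.
  move=> hV; have L20 : 0 < 2 * L by rewrite mulr_gt0.
  have := le_lt_trans (ler_wpM2l (ltW L20) hV) hstep.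
  by rewrite -(ltr_pM2l ha) divff ?gt_eqF//; congr (_ < _); ring.
have D0 : 0 < (1 - beta) ^+ 2 - 2 * (a * L * beta).
  have b20 : 0 < (1 - beta) ^+ 2 by rewrite exprn_gt0// subr_gt0.
  by have := step _ Vb; rewrite mulrA ltr_pdivrMr// mul1r; lra.
have r1 : rho < 1 by exact: rate_lt1 rE D0.
have r0 : 0 <= rho by exact: le_trans br.
have w0 : 0 < 1 - rho ^+ 2 by rewrite subr_gt0 expr_lt1.
have hK := gain_le b0 b1 u0 br rE D0 (step _ Vr).
set K := 8 / (9 * (1 - rho ^+ 2)) in hK.
have K0 : 0 <= K by rewrite divr_ge0// mulr_ge0// ltW.
pose dy2 t := \sum_(0 <= k < t) enorm (y k.+1 - y k) ^+ 2.
have dy20 t : 0 <= dy2 t by apply: sumr_ge0 => k _; exact: sqr_ge0.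
have pi20 : 0 <= pi2 by apply: sumr_ge0 => i _; exact: sqr_ge0.
have cons t : \sum_(0 <= k < t.+1) \sum_i enorm (x k i - y k) ^+ 2 <=
    K * (pi2 / L ^+ 2 + n%:R * dy2 t).
  have := consensus_error_sum n0 hXconv hXcomp hL hflip hE hPE hP hddiff hdconv
    hx0 ha hdda hy0 hy t D0.
  move=> /le_trans; apply; apply: ler_wpM2r hK.
  rewrite addr_ge0 ?(divr_ge0 pi20) ?sqr_ge0//.
  exact: mulr_ge0 (ltW nR0) (dy20 t).
have [Xxs minxs] := hxstar.
have gammaE : gamma = 2^-1 - a * L - a * L * K.
  by rewrite /gamma /K; field; rewrite gt_eqF.
have CE : C = d xstar + a * K * pi2 / (n%:R * L).
  by rewrite /C /K; field; rewrite !gt_eqF.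
have gamma0 : 0 < gamma by have := step _ Vr; rewrite gammaE -/K; lra.
have lyap t : a * \sum_(0 <= k < t) (favg f (y k.+1) - favg f xstar) +
    gamma * dy2 t <= C.
  rewrite gammaE CE; exact: (lyapunov_sum n0 hXconv hXcomp hL hfconv hflip hP
    hddiff hdconv hx0 hdx0 ha hdda hy0 hy t Xxs K0 cons).
have Xy k : X (y k) := y_in hXcomp hP hddiff hx0 hdda hy0 hy k.
(* Optimality of [xstar] against each iterate allows the gap to be dropped when the increments are
   bounded by [C / gamma]. *)
have gap0 t : 0 <= a * \sum_(0 <= k < t) (favg f (y k.+1) - favg f xstar).
  apply: mulr_ge0; first exact: ltW.
  by apply: sumr_ge0 => k _; rewrite subr_ge0; exact: minxs.
have tR0 t : (1 <= t)%N -> (0 : R) < t%:R by rewrite ltr0n.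
split=> [t t1|t i t1]; have {}tR0 := tR0 t t1.
  have h := favg_run_avg_le n0 hXconv hXcomp hfconv hP hddiff hx0 hdda hy0 hy t1.
  rewrite ler_pdivlMr ?mulr_gt0// mulrC.
  apply: le_trans (lyap t); apply: le_trans (_ : _ <=
    a * \sum_(0 <= k < t) (favg f (y k.+1) - favg f xstar)) _; last first.
    by rewrite lerDl; exact: mulr_ge0 (ltW gamma0) (dy20 t).
  rewrite -mulrA ler_pM2l// sumrB sumr_const_nat subn0 -(mulr_natl (favg f xstar)).
  by have := ler_wpM2l (ltW tR0) h; rewrite mulVKf ?gt_eqF// -/ytilde; lra.
have -> : xtilde i t - ytilde t = run_avg (fun k => x k i - y k) t.
  by rewrite /run_avg sumrB scalerBr.
apply: le_trans (enorm_run_avg_sqr _ t1) _.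
rewrite mulrC ler_pM2r ?invr_gt0//.
(* The averages cover times 1 to [t], so the sum must include time [t]; the nonnegative term at time
   0 and the other agents are added. *)
apply: le_trans (_ : _ <= \sum_(0 <= k < t.+1) \sum_i enorm (x k i - y k) ^+ 2) _.
  rewrite [leRHS]big_nat_recl//= -[leLHS]add0r; apply: lerD.
    by apply: sumr_ge0 => j _; exact: sqr_ge0.
  apply: ler_sum => k _; rewrite (bigD1 i)//= lerDl.
  by apply: sumr_ge0 => j _; exact: sqr_ge0.
apply: le_trans (cons t) _; rewrite mulrDr addrC; apply: lerD; last first.
  by rewrite le_eqVlt; apply/orP; left; apply/eqP; rewrite /K; field; rewrite !gt_eqF.
have dyC : dy2 t <= C / gamma.
  by rewrite ler_pdivlMr// mulrC; have := lyap t; have := gap0 t; lra.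
have C0 : 0 <= C / gamma by exact: le_trans dyC.
(* The factor [1 - rho ^+ 2] is weakened to [(1 - rho) ^+ 2], the form it has in the first term of
   [D]. *)
have KK : K <= 8 / (9 * (1 - rho) ^+ 2).
  have s1 : 0 < 9 * (1 - rho) ^+ 2 by rewrite mulr_gt0// exprn_gt0// subr_gt0.
  have s2 : 0 < 9 * (1 - rho ^+ 2) by rewrite mulr_gt0.
  by rewrite /K ler_pM2l// lef_pV2 ?posrE// ler_pM2l//; nra.
have M : K * (n%:R * dy2 t) <= 8 / (9 * (1 - rho) ^+ 2) * (n%:R * (C / gamma)).
  apply: ler_pM K0 (mulr_ge0 (ltW nR0) (dy20 t)) KK _.
  by rewrite (ler_pM2l nR0).
apply: le_trans M _; rewrite le_eqVlt; apply/orP; left; apply/eqP; field.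
by rewrite !gt_eqF// subr_gt0.
Qed.
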